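(* Let $f:X\to S$ be Rohde's family of Calabi--Yau threefolds over $S=\mathbb{P}^1\setminus D$, $\sharp D=3$, with associated local system $\mathbb{V}=R^3f_*\mathbb{C}$ (described in the context). Then $h^1_{L^2}(S,\mathbb{V})=\dim H^1(\bar S,j_*\mathbb{V})=0$, and consequently all Hodge numbers vanish: $$h^1_{L^2}(S,\mathbb{V})^{(4,0)}=h^1_{L^2}(S,\mathbb{V})^{(0,4)}=h^1_{L^2}(S,\mathbb{V})^{(3,1)}=h^1_{L^2}(S,\mathbb{V})^{(1,3)}=h^1_{L^2}(S,\mathbb{V})^{(2,2)}=0.$$
   Context: Rohde's example. This is a family $f:X\to S$ of Calabi--Yau threefolds $X_\lambda$ over $S=\mathbb{P}^1\setminus D$ with $D=\{0,1,\infty\}$, $\bar S=\mathbb{P}^1$, obtained by a Borcea--Voisin construction from a fixed elliptic curve and a family of K3 surfaces (Rohde; Garbagnati--van Geemen). Only the following properties of the example are relevant. (1) There is a family of smooth genus two curves $C_\lambda$, $\lambda\in S$, given by triple coverings $C_\lambda\to\mathbb{P}^1$ with an automorphism of order three. The cohomology $H^1(C_\lambda,\mathbb{C})$ decomposes into eigenspaces for the eigenvalues $\xi$ and $\bar\xi=\xi^2$ ($\xi$ a primitive cube root of unity), each of rank two with one-dimensional $(1,0)$ and $(0,1)$ parts. This gives two rank two (complex) variations of Hodge structures $\mathbb{W}_\xi,\mathbb{W}_{\bar\xi}$ over $S$ of weight one, complex conjugate to each other. (2) $\mathbb{V}=R^3f_*\mathbb{C}$ is a real variation of Hodge structures of weight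 $3$ and rank $4$ with Hodge numbers $(1,1,1,1)$; as a local system $\mathbb{V}=\mathbb{W}_{\bar\xi}\oplus\mathbb{W}_\xi$, with $H^{3,0}(X_\lambda)=H^{1,0}(C_\lambda)_{\bar\xi}$, $H^{2,1}(X_\lambda)=H^{0,1}(C_\lambda)_{\bar\xi}$, $H^{1,2}(X_\lambda)=H^{1,0}(C_\lambda)_{\xi}$, $H^{0,3}(X_\lambda)=H^{0,1}(C_\lambda)_{\xi}$. (3) The Higgs fields (graded Gauss--Manin maps) $\vartheta:E^{3,0}\to E^{2,1}\otimes\Omega^1_{\bar S}(\log D)$ and $\vartheta:E^{1,2}\to E^{0,3}\otimes\Omega^1_{\bar S}(\log D)$ are non-zero, and $\vartheta:E^{2,1}\to E^{1,2}\otimes\Omega^1_{\bar S}(\log D)$ is zero. Here $E^{p,3-p}=F^p/F^{p+1}$ for the extended Hodge filtration $F^\bullet$ on Deligne's quasi-canonical extension (residue eigenvalues in $[0,1)$) of $\mathbb{V}\otimes\mathcal{O}_S$ to $\bar S$. (4) Of the three points of $D$, two have unipotent local monodromy with Jordan blocks of sizes $(2,2)$ on $\mathbb{V}$ (type $II$), and one has quasi-unipotent local monodromy with no eigenvalue equal to $1$ (type $IV$). The Picard--Fuchs equation is a classical hypergeometric equation with singularities at $0,1,\infty$. Notation. $j:S\hookrightarrow\bar S$ is the inclusion; $H^1_{L^2}(S,\mathbb{V})=H^1(\bar S,j_*\mathbb{V})$ carries a pure Hodge structure of weight $4$ (Zucker), and $h^1_{L^2}(S,\mathbb{V})^{(p,q)}$,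 $p+q=4$, denote its Hodge numbers. *)

(* Defs.v *)
From HB Require Import structures.
From mathcomp Require Import all_boot all_order all_algebra.
From mathcomp Require Import complex.
From mathcomp Require Import all_classical all_reals all_analysis.
Set Implicit Arguments.
Unset Strict Implicit.
Unset Printing Implicit Defensive.
Import Order.TTheory GRing.Theory Num.Theory numFieldNormedType.Exports.
Local Open Scope classical_set_scope.
Local Open Scope ring_scope.

Section PuncturedLine.
Variable R : realType.

(* R[i] carries its topology and its complex normed structure as R[i]^o. *)
Local Notation C := (R[i]^o).

Definition P1 := one_point_compactification C.
(* D = {0, 1, oo} *)
Definition cusps : set P1 := [set x | [\/ x = Some 0, x = Some 1 | x = None]].
(* S = P1 minus D; all of S lies in the affine line. *)
Definition Sline : set C := [set z | ~ cusps (Some z)].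
(* j^-1 of a subset of P1 *)
Definition trace (U : set P1) : set C := [set z | Sline z /\ U (Some z)].

(* Local coordinate t at a point s of P1, and the factor d with
   dz = d * (dt / t), i.e. t * d/dt = d * d/dz. *)
Definition lcoord (s : P1) (z : C) : C := if s is Some a then z - a else z^-1.
Definition logfactor (s : P1) (z : C) : C := if s is Some a then z - a else - z.
Definition pdisc (s : P1) (r : C) : set C :=
  [set z | Sline z /\ 0 < `|lcoord s z| < r].

(* The loop |t| = 1/2, run through once counterclockwise in t for th in [0, 1];
   the disc |t| < 1 at a point of D contains no other point of D. *)
Definition loop (s : P1) (th : R) : C :=
  let t : C := (cos (2 * pi * th) +i* sin (2 * pi * th))%C / 2 in
  if s is Some a then a + t else t^-1.

Definition loc_const (U : set C) (f : C -> C) : Prop :=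
  forall z, U z -> \forall w \near z, f w = f z.
Definition holomorphic (U : set C) (f : C -> C) : Prop :=
  forall z, U z -> derivable f z 1.
Definition has_cderiv (U : set C) (f g : C -> C) : Prop :=
  forall z, U z -> is_derive z 1 f (g z).

Fixpoint Ck (k : nat) (U : set (R * R)) (g : R * R -> R) : Prop :=
  if k is k'.+1 then
    [/\ forall p, U p -> differentiable g p,
        Ck k' U (fun p => 'D_(1, 0) g p) & Ck k' U (fun p => 'D_(0, 1) g p)]
  else forall p, U p -> {for p, continuous g}.

Definition toC (p : R * R) : C := (p.1 +i* p.2)%C.
Definition ofC (z : C) : R * R := (complex.Re z, complex.Im z).
Definition rpart (f : C -> C) (p : R * R) : R := complex.Re (f (toC p)).
Definition ipart (f : C -> C) (p : R * R) : R := complex.Im (f (toC p)).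
Definition Cinfty (U : set C) (f : C -> C) : Prop :=
  forall k, Ck k (toC @^-1` U) (rpart f) /\ Ck k (toC @^-1` U) (ipart f).
Definition rderiv (v : R * R) (f : C -> C) (z : C) : C :=
  ('D_v (rpart f) (ofC z) +i* 'D_v (ipart f) (ofC z))%C.
(* Wirtinger derivatives *)
Definition d_z (f : C -> C) (z : C) : C :=
  (rderiv (1, 0) f z - 'i * rderiv (0, 1) f z) / 2.
Definition d_zbar (f : C -> C) (z : C) : C :=
  (rderiv (1, 0) f z + 'i * rderiv (0, 1) f z) / 2.

(* A local system of rank n on S: a family of vector spaces with an atlas of
   frames on open sets covering S, with locally constant transition matrices.
   The fibres over the points outside S are irrelevant. *)
Record local_system (n : nat) := LocalSystem {
  fiber :> C -> vectType R[i];
  atlas : set C -> (forall z, n.-tuple (fiber z)) -> Prop;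
  atlas_open : forall W e, atlas W e -> open W /\ W `<=` Sline;
  atlas_cover : forall z, Sline z -> exists W e, atlas W e /\ W z;
  atlas_basis : forall W e z, atlas W e -> W z -> basis_of fullv (e z);
  atlas_compat : forall W e W' e', atlas W e -> atlas W' e' ->
    forall i j,
      loc_const (W `&` W') (fun z => coord (e z) i (tnth (e' z) j))
}.

(* Set-theoretic sections; only the values over the set where a section is
   considered matter. *)
Definition sec n (V : local_system n) := forall z : C, V z.

Definition in_frames n (V : local_system n) (P : set C -> (C -> C) -> Prop)
    (U : set C) (s : sec V) : Prop :=
  forall W e, atlas W e -> forall i, P (U `&` W) (fun z => coord (e z) i (s z)).
Definition in_frames2 n (V : local_system n)
    (P : set C -> (C -> C) -> (C -> C) -> Prop)
    (U : set C) (s t : sec V) : Prop :=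
  forall W e, atlas W e -> forall i,
    P (U `&` W) (fun z => coord (e z) i (s z)) (fun z => coord (e z) i (t z)).

Definition flat n (V : local_system n) := @in_frames n V loc_const.
Definition holo n (V : local_system n) := @in_frames n V holomorphic.
Definition smooth n (V : local_system n) := @in_frames n V Cinfty.
(* t = nabla_(d/dz) s, for s a holomorphic section of V (x) O_S over U *)
Definition nabla n (V : local_system n) := @in_frames2 n V has_cderiv.
(* The dz- and d(zbar)-components of nabla s, for s a smooth section *)
Definition nabla_z n (V : local_system n) :=
  @in_frames2 n V (fun U f g => forall z, U z -> g z = d_z f z).
Definition nabla_zbar n (V : local_system n) :=
  @in_frames2 n V (fun U f g => forall z, U z -> g z = d_zbar f z).

(* H^1(P1, j_* V) is the Cech H^1 of the sheaf j_* V, the colimit over all open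
   covers. Covers (U x)_(x in P1) with x in U x are cofinal, so that H^1 is the
   space of cocycles modulo the space of coboundaries below, both being
   subspaces of the space of all families c x y; the value of c x y outside
   U x `&` U y is irrelevant. *)
Definition jstar n (V : local_system n) (U : set P1) (s : sec V) : Prop :=
  flat (trace U) s.

Definition cochain1 n (V : local_system n) := P1 -> P1 -> sec V.

Definition pointed_cover (U : P1 -> set P1) : Prop :=
  forall x, open (U x) /\ U x x.

Definition cocycle n (V : local_system n) (c : cochain1 V) : Prop :=
  exists U, [/\ pointed_cover U,
    forall x y, jstar (U x `&` U y) (c x y) &
    forall x y w z, trace (U x `&` U y `&` U w) z ->
      c x w z = c x y z + c y w z].

Definition coboundary n (V : local_system n) (c : cochain1 V) : Prop :=
  exists U (b : P1 -> sec V), [/\ pointed_cover U,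
    forall x, jstar (U x) (b x) &
    forall x y z, trace (U x `&` U y) z -> c x y z = b y z - b x z].

(* dim (A / B) = m, for linear subspaces B <= A of cochain1 V *)
Definition quot_dim n (V : local_system n) (A B : cochain1 V -> Prop)
    (m : nat) : Prop :=
  exists c : 'I_m -> cochain1 V, (forall i, A (c i)) /\
    forall d, A d -> exists! a : {ffun 'I_m -> R[i]},
      B (fun x y z => d x y z - \sum_i a i *: c i x y z).

(* dim H^1(P1, j_* V) = m *)
Definition h1_jstar n (V : local_system n) (m : nat) : Prop :=
  quot_dim (@cocycle n V) (@coboundary n V) m.

Definition hodge_filtration (k : nat) (E : vectType R[i])
    (hpq : nat -> nat -> {vspace E}) (p : nat) : {vspace E} :=
  (\sum_(p <= r < k.+1) hpq r (k - r)%N)%VS.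

(* Real variation of Hodge structures of weight k and rank n on S *)
Record real_vhs (k n : nat) := RealVHS {
  vhs_ls :> local_system n;
  vconj : forall z, vhs_ls z -> vhs_ls z;
  conj_antilinear : forall z, Sline z -> forall (a : R[i]) (u v : vhs_ls z),
    vconj (a *: u + v) = a^* *: vconj u + vconj v;
  conj_involutive : forall z, Sline z -> involutive (@vconj z);
  conj_flat : forall U (s : sec vhs_ls), open U -> U `<=` Sline ->
    flat U s -> flat U (fun z => vconj (s z));
  hpq : forall z, nat -> nat -> {vspace (vhs_ls z)};
  hpq_weight : forall z p q, Sline z -> (p + q)%N != k -> hpq z p q = 0%VS;
  hpq_direct : forall z, Sline z ->
    directv (\sum_(p < k.+1) hpq z p (k - p)%N)%VS;
  hpq_full : forall z, Sline z ->
    (\sum_(p < k.+1) hpq z p (k - p)%N)%VS = fullv;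
  hpq_conj : forall z p q v, Sline z -> v \in hpq z p q -> vconj v \in hpq z q p;
  F_holomorphic : forall p z0, Sline z0 ->
    exists W m (b : forall z, m.-tuple (vhs_ls z)),
      [/\ open W, W z0 & W `<=` Sline] /\
      (forall j, holo W (fun z => tnth (b z) j)) /\
      (forall z, W z -> basis_of (hodge_filtration k (hpq z) p) (b z));
  griffiths : forall p U (s t : sec vhs_ls), open U -> U `<=` Sline ->
    (forall z, U z -> s z \in hodge_filtration k (hpq z) p.+1) ->
    nabla U s t ->
    forall z, U z -> t z \in hodge_filtration k (hpq z) p
}.

Definition Fil k n (V : real_vhs k n) (p : nat) (z : C) : {vspace (V z)} :=
  hodge_filtration k (hpq V z) p.

Record polarization k n (V : real_vhs k n) := Polarization {
  pairing : forall z, V z -> V z -> R[i];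
  pairing_linear : forall z, Sline z -> forall (a : R[i]) (u v w : V z),
    pairing (a *: u + v) w = a * pairing u w + pairing v w;
  pairing_sym : forall z (u v : V z), Sline z ->
    pairing v u = (-1) ^+ k * pairing u v;
  pairing_real : forall z (u v : V z), Sline z ->
    pairing (vconj u) (vconj v) = (pairing u v)^*;
  pairing_flat : forall U (s t : sec V), open U -> U `<=` Sline ->
    flat U s -> flat U t -> loc_const U (fun z => pairing (s z) (t z));
  pairing_orthogonal : forall z p q p' q' u v, Sline z -> p' != q ->
    u \in hpq V z p q -> v \in hpq V z p' q' -> pairing u v = 0;
  pairing_positive : forall z p q v, Sline z -> v \in hpq V z p q -> v != 0 ->
    0 < 'i ^+ p * (- 'i) ^+ q * pairing v (vconj v)
}.

(* Squared Hodge norm on the (p,q)-part: i^(p-q) Q(v, vconj v) *)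
Definition hodge_norm2 k n (V : real_vhs k n) (Q : polarization V)
    (p q : nat) z (v : V z) : R :=
  complex.Re ('i ^+ p * (- 'i) ^+ q * pairing Q v (vconj v)).

(* H^(P,Q) in Zucker's Hodge structure on H^1(P1, j_* V): the classes of
   L^2 harmonic V-valued 1-forms of total type (P,Q). On the curve S a smooth
   form of pure type (P,Q), eta = eta1 dz + eta2 d(zbar) with eta1 of type
   (P-1,Q) and eta2 of type (P,Q-1), is harmonic if and only if it is closed
   (Kaehler identities); the L^2 norm of a 1-form depends on the Hodge metric of
   V only, not on the conformal metric chosen on S. The form eta represents the
   class of c if eta = nabla (u x) on U x and c x y = u y - u x; in particular
   eta is closed. *)
Definition coef_type k n (V : real_vhs k n) (z : C) (P Q : nat) (is_dz : bool)
    : {vspace (V z)} :=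
  if is_dz then (if P is P'.+1 then hpq V z P' Q else 0%VS)
  else (if Q is Q'.+1 then hpq V z P Q' else 0%VS).

Definition zucker_class k n (V : real_vhs k n) (Q : polarization V)
    (p q : nat) (c : cochain1 V) : Prop :=
  exists U (u : P1 -> sec V) (eta1 eta2 : sec V),
    [/\ pointed_cover U,
        forall x, smooth (trace (U x)) (u x),
        forall x, nabla_z (trace (U x)) (u x) eta1,
        forall x, nabla_zbar (trace (U x)) (u x) eta2 &
        forall x y z, trace (U x `&` U y) z -> c x y z = u y z - u x z] /\
    [/\ forall z, Sline z -> eta1 z \in coef_type V z p q true,
        forall z, Sline z -> eta2 z \in coef_type V z p q false &
        (\int[(@lebesgue_measure R) \x (@lebesgue_measure R)]_(x in
            toC @^-1` Sline)
           (hodge_norm2 Q p.-1 q (eta1 (toC x))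
            + hodge_norm2 Q p q.-1 (eta2 (toC x)))%:E < +oo)%E].

(* h^1_(L^2)(S, V)^(p,q) = m *)
Definition h1_hodge k n (V : real_vhs k n) (Q : polarization V) (p q m : nat)
    : Prop :=
  quot_dim (zucker_class Q p q) (@coboundary n V) m.

(* Frame near s of Deligne's quasi-canonical extension: nabla has a logarithmic
   pole with residue A 0 whose eigenvalues lie in [0, 1). *)
Definition deligne_frame n (V : local_system n) (s : P1) (r : C)
    (e : forall z, n.-tuple (V z)) : Prop :=
  0 < r /\ (forall z, pdisc s r z -> basis_of fullv (e z)) /\
  exists A : C -> 'M[R[i]]_n,
    [/\ forall i j, holomorphic [set t | `|t| < r] (fun t => A t i j),
        forall j, exists tau : sec V,
          nabla (pdisc s r) (fun z => tnth (e z) j) tau /\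
          forall z, pdisc s r z ->
            logfactor s z *: tau z =
              \sum_i A (lcoord s z) i j *: tnth (e z) i &
        forall a, eigenvalue (A 0) a -> 0 <= a < 1].

(* s0 extends over s to a section of the quasi-canonical extension *)
Definition deligne_section n (V : local_system n) (s : P1) (s0 : sec V)
    : Prop :=
  exists r e (h : 'I_n -> C -> C), deligne_frame s r e /\
    forall i, holomorphic [set t | `|t| < r] (h i) /\
      forall z, pdisc s r z -> coord (e z) i (s0 z) = h i (lcoord s z).

(* Sections over U of the extended F^p, and of (extended F^p) (x) Omega^1(log D);
   in the second case tau stands for the form tau dz. *)
Definition Fbar k n (V : real_vhs k n) (p : nat) (U : set P1) (s0 : sec V)
    : Prop :=
  [/\ holo (trace U) s0, forall s, cusps s -> U s -> deligne_section s s0 &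
      forall z, trace U z -> s0 z \in Fil V p z].
Definition Fbar_log k n (V : real_vhs k n) (p : nat) (U : set P1)
    (tau : sec V) : Prop :=
  [/\ holo (trace U) tau,
      forall s, cusps s -> U s -> deligne_section s (fun z => logfactor s z *: tau z)
    & forall z, trace U z -> tau z \in Fil V p z].

(* theta : E^(p,k-p) -> E^(p-1,k-p+1) (x) Omega^1(log D) is zero: nabla maps
   (extended F^p) into (extended F^p) (x) Omega^1(log D). *)
Definition higgs_zero k n (V : real_vhs k n) (p : nat) : Prop :=
  forall U (s t : sec V), open U -> Fbar p U s -> nabla (trace U) s t ->
    Fbar_log p U t.

(* Paths in the total space of V *)
Definition parallel n (V : local_system n) (g : R -> C)
    (rho : R -> {z : C & V z}) : Prop :=
  (forall th, 0 <= th <= 1 -> tag (rho th) = g th) /\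
  forall W e i th, atlas W e -> 0 <= th <= 1 -> W (g th) ->
    \forall th' \near th, 0 <= th' <= 1 ->
      coord (e (tag (rho th'))) i (tagged (rho th')) =
      coord (e (tag (rho th))) i (tagged (rho th)).

Definition local_monodromy n (V : local_system n) (s : P1)
    (T : 'End(V (loop s 0))) : Prop :=
  forall v, exists rho : R -> {z : C & V z},
    [/\ parallel (loop s) rho, rho 0 = existT _ (loop s 0) v &
        rho 1 = existT _ (loop s 0) (T v)].

(* Unipotent, with two Jordan blocks of size two *)
Definition type_II (E : vectType R[i]) (T : 'End(E)) : Prop :=
  exists b0 b1 b2 b3, basis_of fullv [:: b0; b1; b2; b3] /\
    [/\ T b0 = b0, T b1 = b0 + b1, T b2 = b2 & T b3 = b2 + b3].

Definition eigen (E : vectType R[i]) (T : 'End(E)) (a : R[i]) : {vspace E} :=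
  lker (T - a *: \1%VF).

(* Quasi-unipotent, without the eigenvalue 1 *)
Definition type_IV (E : vectType R[i]) (T : 'End(E)) : Prop :=
  (exists m k : nat, (0 < m)%N /\
     forall v, iter k (fun u => iter m T u - u) v = 0) /\
  eigen T 1 = 0%VS.

(* Second order Fuchsian equation with the singularities 0, 1, oo, exponents
   (a, a') at 0, (c, c') at 1 and (b, b') at oo, for the section om with
   nabla-derivatives om1 and om2. Multiplication by z^a (1 - z)^c relates it to
   Gauss's equation, which is the case a = c = 0. *)
Definition hypergeometric n (V : local_system n) (om om1 om2 : sec V)
    : Prop :=
  exists a a' b b' c c' : C, a + a' + b + b' + c + c' = 1 /\
    forall z, Sline z ->
      om2 z + ((1 - a - a') / z + (1 - c - c') / (z - 1)) *: om1 z
      + ((- (a * a') / z + c * c' / (z - 1) + b * b') / (z * (z - 1))) *: om z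
      = 0.

(* V = R^3 f_* C for Rohde's family. HC is the variation H^1(C_l) of the genus
   two curves, sigma the action of the automorphism of order three, and
   W_a = eigen sigma a; the conjugate of xi is xi^2. *)
Record rohde_family (V : real_vhs 3 4) := RohdeFamily {
  HC : real_vhs 1 4;
  sigma : forall z, 'End(HC z);
  sigma_order : forall z v, Sline z -> sigma z (sigma z (sigma z v)) = v;
  sigma_flat : forall U (s : sec HC), open U -> U `<=` Sline ->
    flat U s -> flat U (fun z => sigma z (s z));
  sigma_real : forall z v, Sline z -> sigma z (vconj v) = vconj (sigma z v);
  sigma_hodge : forall z p q v, Sline z ->
    v \in hpq HC z p q -> sigma z v \in hpq HC z p q;
  xi : R[i];
  xi_prim : 3.-primitive_root xi;
  W_dim : forall z a, Sline z -> a = xi \/ a = xi ^+ 2 ->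
    [/\ \dim (eigen (sigma z) a) = 2%N,
        \dim (eigen (sigma z) a :&: hpq HC z 1 0) = 1%N &
        \dim (eigen (sigma z) a :&: hpq HC z 0 1) = 1%N];
  hodge_numbers : forall z, Sline z ->
    [/\ \dim (hpq V z 3 0) = 1%N, \dim (hpq V z 2 1) = 1%N,
        \dim (hpq V z 1 2) = 1%N & \dim (hpq V z 0 3) = 1%N];
  (* the isomorphism of complex local systems of W_(xi^2) (+) W_xi with V *)
  phi : forall z, 'Hom(HC z, V z);
  phi_iso : forall z, Sline z ->
    [/\ lker (phi z) = 0%VS, limg (phi z) = fullv &
        (eigen (sigma z) (xi ^+ 2) + eigen (sigma z) xi)%VS = fullv];
  phi_flat : forall U (s : sec HC), open U -> U `<=` Sline ->
    flat U s -> flat U (fun z => phi z (s z));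
  phi_hodge : forall z, Sline z ->
    [/\ hpq V z 3 0 = (phi z @: (eigen (sigma z) (xi ^+ 2) :&: hpq HC z 1 0))%VS,
        hpq V z 2 1 = (phi z @: (eigen (sigma z) (xi ^+ 2) :&: hpq HC z 0 1))%VS,
        hpq V z 1 2 = (phi z @: (eigen (sigma z) xi :&: hpq HC z 1 0))%VS &
        hpq V z 0 3 = (phi z @: (eigen (sigma z) xi :&: hpq HC z 0 1))%VS];
  higgs : [/\ ~ higgs_zero V 3, ~ higgs_zero V 1 & higgs_zero V 2];
  monodromy : exists s4 : P1, cusps s4 /\
    (exists T : 'End(V (loop s4 0)), local_monodromy T /\ type_IV T) /\
    forall s : P1, cusps s -> s <> s4 ->
      exists T : 'End(V (loop s 0)), local_monodromy T /\ type_II T;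
  picard_fuchs : exists om om1 om2 : sec V,
    [/\ forall z, Sline z -> om z \in Fil V 3 z /\ om z != 0,
        nabla Sline om om1, nabla Sline om1 om2 & hypergeometric om om1 om2]
}.

End PuncturedLine.

(* Main.v *)
(* Only the topology of V matters. Let s4 be the cusp of type IV and a, b the
   other two. A class in H^1(P1, j_* V) is a torsor under V on S with a flat
   section near each cusp. Cutting S along the real line, a flat section near a
   (of V or of the torsor) extends over the complement P_a of the real arc joining
   the other two cusps, and likewise for b. The vectors at 'i fixed by the two
   type II monodromies span two planes; they meet in 0, because a flat section
   on both P_a and P_b is global, hence fixed by the monodromy at s4, which has
   no eigenvalue 1. So the fibre is the sum of the two planes, and torsor sections
   on P_a and P_b can be corrected to agree at 'i, hence on the simply connected
   intersection, giving a global section. Zucker classes are cocycles since a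
   smooth function with vanishing Wirtinger derivatives is locally constant. *)
Require Import Defs.
From mathcomp Require Import all_boot all_order all_algebra.
From mathcomp Require Import complex ring lra.
From mathcomp Require Import all_classical all_reals all_analysis.
Set Implicit Arguments.
Unset Strict Implicit.
Unset Printing Implicit Defensive.
Import Order.TTheory GRing.Theory Num.Theory numFieldNormedType.Exports.
Local Open Scope classical_set_scope.
Local Open Scope ring_scope.

(** * Segments and boxes in the plane *)

Section Plane.
Variable R : realType.
Local Notation C := (R[i]^o).
Implicit Types (z w p q : C) (a b t u e d : R).

Lemma ReD z w : complex.Re (z + w) = complex.Re z + complex.Re w.
Proof. by case: z w => ? ? []. Qed.

Lemma ImD z w : complex.Im (z + w) = complex.Im z + complex.Im w.
Proof. by case: z w => ? ? []. Qed.

Lemma ReN z : complex.Re (- z) = - complex.Re z.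
Proof. by case: z. Qed.

Lemma ImN z : complex.Im (- z) = - complex.Im z.
Proof. by case: z. Qed.

(** Open squares instead of discs: real and imaginary parts are then handled separately, by linear
    inequalities. *)
Definition box z e : set C :=
  [set w | `|complex.Re w - complex.Re z| < e /\
           `|complex.Im w - complex.Im z| < e].

Lemma nbhs_boxP z (P : set C) :
  nbhs z P <-> exists2 e : R, 0 < e & box z e `<=` P.
Proof.
split.
  (* A positive element of [R[i]] is real, so the radius has no imaginary part. The square of
     half-side [e / 2] lies in the disc of radius [e]. *)
  move=> /nbhs_ballP [[e e'] /=]; rewrite ltcE /= => /andP[/eqP -> e0] zP.
  exists (e / 2); first by lra.
  move=> w [wx wy]; apply: zP; rewrite /ball /= normc_def ltcR.
  rewrite ReD ImD ReN ImN.
  rewrite -(@ltr_pXn2r _ 2%N) ?nnegrE ?sqrtr_ge0 ?(ltW e0) // sqr_sqrtr ?addr_ge0 ?sqr_ge0 //.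
  move: wx wy; rewrite !ltr_norml => /andP[? ?] /andP[? ?].
  nra.
move=> [e e0 eP]; apply/nbhs_ballP; exists e%:C%C => /=; first by rewrite ltcR.
move=> w; rewrite /ball /= normc_def ltcR => zw; apply: eP.
move: zw; rewrite ReD ImD ReN ImN => zw; split; apply: le_lt_trans zw.
  by rewrite distrC -sqrtr_sqr; apply: ler_wsqrtr; rewrite lerDl sqr_ge0.
by rewrite distrC -sqrtr_sqr; apply: ler_wsqrtr; rewrite lerDr sqr_ge0.
Qed.

(** Connectedness of [a, b], through the supremum of the times up to which a predicate holds
    throughout. Local constancy is asked only inside the interval, so the end points are covered as
    well. *)
Lemma itv_connected_ind (P : R -> Prop) a b :
  (forall t, a <= t <= b -> \forall u \near t, a <= u <= b -> (P u <-> P t)) ->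
  forall t u, a <= t <= b -> a <= u <= b -> P t -> P u.
Proof.
move=> Ploc.
(* Propagation from the left end suffices: it is applied to the predicate [P t <-> P a], which holds
   at [a]. *)
suff main (Q : R -> Prop) : a <= b ->
    (forall t, a <= t <= b -> \forall u \near t, a <= u <= b -> (Q u <-> Q t)) ->
    Q a -> forall t, a <= t <= b -> Q t.
  move=> t u tab uab; have ab : a <= b by lra.
  have H : forall t, a <= t <= b -> (P t <-> P a).
    apply: main => //= r /Ploc; apply: filterS => v /[apply] ?; tauto.
  by move=> Pt; apply/(H u uab)/(H t tab).
move=> ab Qloc Qa.
pose A := [set t | a <= t <= b /\ forall u, a <= u <= t -> Q u].
have Aa : A a by split=> [|u ua]; [lra|have -> : u = a by lra].
have hA : has_sup A by split; [exists a|exists b => x [/andP[]]].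
have As x : A x -> x <= sup A by exact: sup_upper_bound hA x.
have sab : a <= sup A <= b.
  by rewrite As //=; apply: ge_sup; [exists a|move=> x [/andP[]]].
have /nbhs_ballP[d /= d0 dQ] := Qloc _ sab.
have [x [xab xQ] xs] := sup_adherent d0 hA.
have xA : x <= sup A by apply: As; split.
have Qs : Q (sup A).
  have Qx : Q x by apply: xQ; lra.
  by apply/(dQ x) => //; rewrite /ball /= ltr_norml; lra.
have Qd t : sup A - d < t < sup A + d -> a <= t <= b -> Q t.
  by move=> td tab; apply/dQ => //; rewrite /ball /= ltr_norml; lra.
have Qlt t : a <= t <= b -> t < sup A + d -> Q t.
  move=> tab td; have [tx|tx] := leP t x; first by apply: xQ; lra.
  by apply: Qd => //; lra.
have sb : sup A = b.
  apply/eqP; rewrite eq_le; apply/andP; split; first by lra.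
  rewrite leNgt; apply/negP => sltb.
  have [y [y1 [y2 y3]]] : exists y, [/\ sup A < y, y <= b & y < sup A + d].
    exists (Num.min b (sup A + d / 2)); split.
    + by rewrite lt_min; apply/andP; split; lra.
    + by rewrite ge_min lexx.
    + by rewrite gt_min; apply/orP; right; lra.
  have : A y by split; [lra|move=> u uy; apply: Qlt; lra].
  by move=> /As; lra.
by move=> t tab; apply: Qlt => //; lra.
Qed.

Definition seg p q t : C := p + t%:C%C * (q - p).

Lemma Re_seg p q t :
  complex.Re (seg p q t) = complex.Re p + t * (complex.Re q - complex.Re p).
Proof. by case: p q => p1 p2 [q1 q2] /=; rewrite mul0r subr0. Qed.

Lemma Im_seg p q t :
  complex.Im (seg p q t) = complex.Im p + t * (complex.Im q - complex.Im p).
Proof. by case: p q => p1 p2 [q1 q2] /=; rewrite mul0r addr0. Qed.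

Lemma complex_eqP z w : complex.Re z = complex.Re w -> complex.Im z = complex.Im w -> z = w.
Proof. by case: z w => ? ? [? ?] /= -> ->. Qed.

Lemma seg0 p q : seg p q 0 = p.
Proof. by apply: complex_eqP; rewrite ?Re_seg ?Im_seg mul0r addr0. Qed.

Lemma seg1 p q : seg p q 1 = q.
Proof. by apply: complex_eqP; rewrite ?Re_seg ?Im_seg mul1r addrC subrK. Qed.

Lemma cvg_complex (g : R -> C) t :
  {for t, continuous (fun u => complex.Re (g u))} ->
  {for t, continuous (fun u => complex.Im (g u))} ->
  {for t, continuous g}.
Proof.
move=> gR gI P /nbhs_boxP[e e0 eP].
have Ne (h : R -> R) : {for t, continuous h} -> \forall u \near t, `|h u - h t| < e.
  by move=> /cvgrPdist_lt/(_ e e0); apply: filterS => u; rewrite distrC.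
apply: filterS (filterI (Ne _ gR) (Ne _ gI)) => u [h1 h2]; exact: eP.
Qed.

Lemma continuous_seg p q : continuous (seg p q).
Proof.
move=> t; apply: cvg_complex.
  have -> : (fun u => complex.Re (seg p q u)) =
            (fun u => complex.Re p + u * (complex.Re q - complex.Re p)).
    by apply/funext => u; rewrite Re_seg.
  by apply: cvgD; [exact: cvg_cst|apply: cvgM; [exact: cvg_id|exact: cvg_cst]].
have -> : (fun u => complex.Im (seg p q u)) =
          (fun u => complex.Im p + u * (complex.Im q - complex.Im p)).
  by apply/funext => u; rewrite Im_seg.
by apply: cvgD; [exact: cvg_cst|apply: cvgM; [exact: cvg_id|exact: cvg_cst]].
Qed.

Definition segment_convex (N : set C) :=
  forall x y, N x -> N y -> forall t, 0 <= t <= 1 -> N (seg x y t).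

Lemma box_convex z e : segment_convex (box z e).
Proof.
move=> x y [x1 x2] [y1 y2] t t01; rewrite /box /= Re_seg Im_seg.
move: x1 x2 y1 y2; rewrite !ltr_norml => /andP[a1 a2] /andP[a3 a4] /andP[a5 a6] /andP[a7 a8].
have conv a b u v : a < u < b -> a < v < b -> a < u + t * (v - u) < b.
  move=> /andP[? ?] /andP[? ?]; have [t1 t2] := andP t01.
  have [->|t3] := eqVneq t 1; first by rewrite mul1r; lra.
  have {}t3 : t < 1 by rewrite lt_neqAle t3.
  by apply/andP; split; nra.
split.
  have := conv (complex.Re z - e) (complex.Re z + e) (complex.Re x) (complex.Re y).
  by move=> H; have := H ltac:(lra) ltac:(lra); lra.
have := conv (complex.Im z - e) (complex.Im z + e) (complex.Im x) (complex.Im y).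
by move=> H; have := H ltac:(lra) ltac:(lra); lra.
Qed.

Lemma box_open z e w : box z e w -> nbhs w (box z e).
Proof.
move=> [h1 h2]; apply/nbhs_boxP.
exists (Num.min (e - `|complex.Re w - complex.Re z|) (e - `|complex.Im w - complex.Im z|)).
  by rewrite lt_min !subr_gt0 h1 h2.
move=> x []; rewrite !lt_min => /andP[x1 _] /andP[_ x2]; split.
  have := ler_distD (complex.Re w) (complex.Re x) (complex.Re z); lra.
have := ler_distD (complex.Im w) (complex.Im x) (complex.Im z); lra.
Qed.

Lemma box_sub z d e : d <= e -> box z d `<=` box z e.
Proof. by move=> de w [? ?]; split; apply: lt_le_trans de. Qed.

Lemma box_center z e : 0 < e -> box z e z.
Proof. by move=> e0; split; rewrite subrr normr0. Qed.

End Plane.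

(** * Flat sections over star-shaped sets *)

Section Etale.
Variable R : realType.
Local Notation C := (R[i]^o).

(** The properties shared by the flat sections of a local system and those of a torsor under it, so
    that continuation is done once for both. [flat_at_eq] makes agreement of two flat sections open
    and closed; [flat_at_ext] is local triviality, with one [B] serving all its points and values.
    [stalk_point] is a default value. *)
Record etale_space (S : set C) := EtaleSpace {
  stalk :> C -> Type;
  stalk_point : forall z, stalk z;
  flat_at : (forall z, stalk z) -> C -> Prop;
  flat_at_near : forall s t z, flat_at s z ->
    (\forall w \near z, s w = t w) -> flat_at t z;
  flat_at_eq : forall s t z, S z -> flat_at s z -> flat_at t z ->
    \forall w \near z, s w = t w <-> s z = t z;
  flat_at_ext : forall z, S z -> exists B, [/\ nbhs z B, B `<=` S &
    forall w (v : stalk w), B w ->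
      exists2 s, s w = v & forall x, B x -> flat_at s x]
}.

Variables (S : set C) (F : etale_space S).
Implicit Types (s t : forall z, F z) (p q z w : C) (N Y : set C).

Lemma total_inj z (u v : F z) : existT F z u = existT F z v -> u = v.
Proof. exact: (@existT_inj2 C F). Qed.

(** A path in the total space rather than a section: over a closed path the values at the two ends
    may differ. *)
Definition flat_along (g : R -> C) (rho : R -> {z : C & F z}) (a b : R) :=
  forall u, a <= u <= b -> exists2 s, flat_at s (g u) &
    \forall u' \near u, a <= u' <= b -> rho u' = existT F (g u') (s (g u')).

Lemma flat_along_sub g rho a b a' b' : a <= a' -> b' <= b ->
  flat_along g rho a b -> flat_along g rho a' b'.
Proof.
move=> aa bb h u uab; have [|s s1 s2] := h u; first by lra.
by exists s => //; apply: filterS s2 => x + ?; apply; lra.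
Qed.

Lemma flat_along_section g s a b : (forall u, a <= u <= b -> flat_at s (g u)) ->
  flat_along g (fun u => existT F (g u) (s (g u))) a b.
Proof. by move=> h u uab; exists s; [exact: h|exact: filterE]. Qed.

(** By [flat_at_eq] the truth of [rho u] lying on [s] is locally constant in the time [u], and the
    interval is connected. *)
Lemma flat_along_unique g rho s a b : continuous g -> flat_along g rho a b ->
  (forall u, a <= u <= b -> S (g u) /\ flat_at s (g u)) ->
  forall u u', a <= u <= b -> a <= u' <= b ->
  rho u = existT F (g u) (s (g u)) -> rho u' = existT F (g u') (s (g u')).
Proof.
move=> gc rhoF sF; apply: itv_connected_ind => u uab.
have [t t1 t2] := rhoF u uab; have [Su su] := sF u uab.
have tE : \forall x \near u, t (g x) = s (g x) <-> t (g u) = s (g u).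
  exact: (gc u _ (flat_at_eq Su t1 su)).
apply: filterS (filterI t2 tE) => x [xE [x1 x2]] xab; rewrite xE //.
rewrite (nbhs_singleton t2 uab).
by split=> /total_inj E; congr existT; [apply: x1|apply: x2].
Qed.

Lemma seg_unique s t p z :
  (forall u, 0 <= u <= 1 -> [/\ S (seg p z u), flat_at s (seg p z u) &
     flat_at t (seg p z u)]) ->
  s p = t p -> s z = t z.
Proof.
move=> h E.
have := @flat_along_unique _ _ t 0 1 (@continuous_seg _ p z)
  (@flat_along_section (seg p z) s 0 1 _) _ 0 1.
rewrite seg0 seg1 E => H; apply: total_inj; apply: H => //; last 2 first.
- by rewrite lexx ler01.
- by rewrite lexx ler01.
- by move=> u /h[].
- by move=> u /h[].
Qed.

Lemma convex_unique N s t p : segment_convex N -> N `<=` S ->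
  (forall z, N z -> flat_at s z /\ flat_at t z) -> N p -> s p = t p ->
  forall z, N z -> s z = t z.
Proof.
move=> cN NS st Np E z Nz; apply: seg_unique E => u u01.
have Nu := cN _ _ Np Nz _ u01; split;
  [exact: NS|exact: (st _ Nu).1|exact: (st _ Nu).2].
Qed.

(** Inside [A] the glued section is [s] near [z]. Otherwise [B] is a neighbourhood of [z], and there
    both branches equal [t] because [s] and [t] agree on the overlap. *)
Lemma flat_glue (A B : set C) s t z : nbhs z A \/ ~ A z /\ nbhs z B ->
  (nbhs z A -> flat_at s z) -> (nbhs z B -> flat_at t z) ->
  (nbhs z B -> \forall w \near z, A w -> B w -> s w = t w) ->
  flat_at (fun w => if pselect (A w) then s w else t w) z.
Proof.
move=> [zA fs _ _|[_ zB] _ ft E].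
  apply: flat_at_near (fs zA) _; apply: filterS zA => w ?.
  by case: pselect.
apply: flat_at_near (ft zB) _; apply: filterS (filterI zB (E zB)) => w [? ?].
by case: pselect => // ?; apply/esym; auto.
Qed.

(** * Continuation along the rays from a centre *)

Section Star.
Variables (p : C) (v : F p).

Let good z := exists N s, [/\ segment_convex N, forall w, N w -> nbhs w N,
  N `<=` S, N p & N z] /\ (s p = v /\ forall w, N w -> flat_at s w).

Let good_unique z N s N' s' :
  [/\ segment_convex N, forall w, N w -> nbhs w N, N `<=` S, N p & N z] /\
    (s p = v /\ forall w, N w -> flat_at s w) ->
  [/\ segment_convex N', forall w, N' w -> nbhs w N', N' `<=` S, N' p & N' z] /\
    (s' p = v /\ forall w, N' w -> flat_at s' w) ->
  s z = s' z.
Proof.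
move=> [[c1 _ NS Np Nz] [E fs]] [[c2 _ _ Np' Nz'] [E' fs']].
apply: (@convex_unique (N `&` N') s s' p) => //.
- by move=> x y [? ?] [? ?] u u01; split; [apply: c1|apply: c2].
- by move=> ? [/NS].
- by move=> w [? ?]; split; auto.
- by rewrite E E'.
Qed.

Let good_seg z (u e a b : R) : 0 < e -> box (seg p z u) e `<=` S ->
  (forall w (v' : F w), box (seg p z u) e w -> exists2 s, s w = v' &
     forall x, box (seg p z u) e x -> flat_at s x) ->
  0 <= a -> 0 <= b ->
  (forall c : R, Num.min a b <= c <= Num.max a b -> box (seg p z u) (e / 2) (seg p z c)) ->
  good (seg p z a) -> good (seg p z b).
Proof.
move=> e0 BS Bext a0 b0 Hc [N [s [[cN oN NS Np Nz] [E fs]]]].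
have [ba|ab] := leP b a.
  exists N, s; split => //; split => //.
  have [a0'|a0'] := eqVneq a 0.
    have -> : b = 0 by lra.
    by rewrite seg0.
  have -> : seg p z b = seg p (seg p z a) (b / a).
    by apply: complex_eqP; rewrite ?(Re_seg, Im_seg); field.
  apply: cN => //; have a1 : 0 < a by rewrite lt_neqAle eq_sym a0'.
  by rewrite divr_ge0 //= ler_pdivrMr // mul1r.
move: Hc; rewrite min_l ?(ltW ab) // max_r ?(ltW ab) // => Hc.
have [e1 e10 eN1] := (nbhs_boxP _ _).1 (oN _ Np).
have [e2 e20 eN2] := (nbhs_boxP _ _).1 (oN _ Nz).
pose d := Num.min (e / 2) (Num.min e1 e2).
have d0 : 0 < d by rewrite !lt_min e10 e20 divr_gt0.
have de : d <= e / 2 by rewrite ge_min lexx.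
have d1 : d <= e1 by rewrite !ge_min lexx orbT.
have d2 : d <= e2 by rewrite !ge_min lexx !orbT.
pose B := box (seg p z u) e.
pose N' : set C := [set w | exists2 c : R, 0 <= c <= b & box (seg p z c) d w].
have N'NB w : N' w -> N w \/ B w.
  move=> [c cb wc]; have [ca|ac] := leP c a; [left|right]; last first.
    have [h1 h2] : box (seg p z u) (e / 2) (seg p z c) by apply: Hc; lra.
    have [h3 h4] := box_sub de wc; split.
      have := ler_distD (complex.Re (seg p z c)) (complex.Re w) (complex.Re (seg p z u)); lra.
    have := ler_distD (complex.Im (seg p z c)) (complex.Im w) (complex.Im (seg p z u)); lra.
  have [a0'|a0'] := eqVneq a 0.
    apply: eN1; have c0 : c = 0 by lra.
    by move: wc; rewrite c0 seg0; exact: (box_sub d1).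
  have a1 : 0 < a by rewrite lt_neqAle eq_sym a0'.
  (* The segment from [p] to [seg p z a], translated by [dw], has both ends in the convex set [N]
     and passes through [w] at time [c / a]. *)
  pose dw : C := w - seg p z c.
  have Ew : w = seg (p + dw) (seg p z a + dw) (c / a).
    by apply: complex_eqP; rewrite ?(Re_seg, Im_seg, ReD, ImD, ReN, ImN); field.
  have Bdw x : box x d (x + dw).
    move: wc; rewrite /box /dw /=; case: (seg p z c) => ? ?; case: (w) => ? ?;
      case: x => x1 x2 /=.
    by rewrite ![_ + (_ - _)]addrC ![_ - _ + _ - _]addrK.
  rewrite Ew; apply: cN; last by rewrite divr_ge0 ?ler_pdivrMr ?mul1r//=; lra.
    by apply: eN1; exact: (box_sub d1 (Bdw _)).
  by apply: eN2; exact: (box_sub d2 (Bdw _)).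
have Ba : B (seg p z a).
  by apply: (@box_sub _ _ (e / 2)); [lra|apply: Hc; rewrite lexx ltW].
(* [s'] continues [s]: equal at [seg p z a], they agree on the convex set where both are defined. *)
have [s' s'E fs'] := Bext _ (s (seg p z a)) Ba.
exists N', (fun w => if pselect (N w) then s w else s' w); split; last split.
- split.
  + move=> x y [c cb xc] [c' cb' yc] r r01; exists (c + r * (c' - c)).
      by have [? ?] := andP r01; apply/andP; split; nra.
    have xc' : box (0 : C) d (x - seg p z c).
      move: xc; rewrite /box /=; case: (seg p z c) => ? ?; case: x => ? ? /=.
      by rewrite !subr0.
    have yc' : box (0 : C) d (y - seg p z c').
      move: yc; rewrite /box /=; case: (seg p z c') => ? ?; case: y => ? ? /=.
      by rewrite !subr0.
    have := box_convex xc' yc' r01.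
    have <- : seg x y r - seg p z (c + r * (c' - c)) =
       seg (x - seg p z c) (y - seg p z c') r.
      by rewrite /seg rmorphD rmorphM rmorphB /=; ring.
    rewrite /box /=; case: (seg x y r) => ? ?;
      case: (seg p z (c + r * (c' - c))) => ? ? /=.
    by rewrite !subr0.
  + by move=> w [c cb /box_open]; apply: filterS => x; exists c.
  + by move=> w /N'NB[/NS|/BS].
  + by exists 0; [rewrite lexx ltW // (le_lt_trans a0)|rewrite seg0;
      apply: box_center].
  + by exists b; [rewrite lexx ltW // (le_lt_trans a0)|apply: box_center].
- by case: pselect.
move=> w /N'NB NB; apply: (@flat_glue N B) => //.
- have [Nw|Nw] := pselect (N w); [left; exact: oN|right; split => //].
  by case: NB => // /box_open.
- by move=> /nbhs_singleton/fs.
- by move=> /nbhs_singleton/fs'.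
- move=> _; apply: filterE => x Nx Bx.
  apply: (@convex_unique (N `&` B) s s' (seg p z a)) => //.
  + by move=> y y' [? ?] [? ?] r r01; split;
      [apply: cN|apply: (@box_convex _ (seg p z u) e)].
  + by move=> ? [/NS].
  + by move=> y [? ?]; split; [apply: fs|apply: fs'].
Qed.

(* Two flat sections through v on convex open sets containing p agree where both
   are defined; such sections exist near every z in Y by continuation along the
   segment from p to z. *)
Lemma flat_section_star Y : Y p ->
  (forall z, Y z -> forall u, 0 <= u <= 1 -> S (seg p z u)) ->
  exists2 s, s p = v & forall z, Y z -> flat_at s z.
Proof.
move=> Yp YS.
have gY z : Y z -> good z.
  move=> Yz; rewrite -(seg1 p z).
  have good0 : good (seg p z 0).
    have [|B [Bp BS Bext]] := @flat_at_ext _ F (seg p z 0).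
      by apply: YS; rewrite ?lexx ?ler01.
    move: Bp Bext; rewrite seg0 => Bp Bext.
    have [e e0 eB] := (nbhs_boxP _ _).1 Bp.
    have [s sE sF] := Bext p v (nbhs_singleton Bp).
    exists (box p e), s; split; split => //.
    + exact: box_convex.
    + by move=> w; apply: box_open.
    + by move=> w /eB/BS.
    + exact: box_center.
    + exact: box_center.
    + by move=> w /eB/sF.
  move: good0; apply: (@itv_connected_ind _ (good \o seg p z) 0 1);
    rewrite ?lexx ?ler01 //.
  move=> u u01; have [B [Bu BS Bext]] := flat_at_ext F (YS _ Yz u u01).
  have [e e0 eB] := (nbhs_boxP _ _).1 Bu.
  have nu : nbhs (seg p z u) (box (seg p z u) (e / 2)).
    by apply: box_open; apply: box_center; lra.
  have /nbhs_ballP[d /= d0 dB] := @continuous_seg _ p z u _ nu.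
  have step a b : ball u d a -> ball u d b -> 0 <= a -> 0 <= b ->
      good (seg p z a) -> good (seg p z b).
    move=> ua ub a0 b0; apply: (@good_seg z u e) => //.
    - by move=> w /eB/BS.
    - by move=> w v' /eB /Bext -/(_ v')[s ? sF]; exists s => // x /eB/sF.
    - move=> c; rewrite ge_min le_max => cab; apply: dB.
      move: ua ub; rewrite /ball /= !ltr_norml => ua ub;
        case/andP: cab => /orP[?|?] /orP[?|?]; lra.
  apply/nbhs_ballP; exists d => // w uw w01 /=.
  by split; apply: step => //; try exact: ballxx; lra.
have goodE z : good z -> exists x : F z, exists N s,
    ([/\ segment_convex N, forall w, N w -> nbhs w N, N `<=` S, N p & N z] /\
    (s p = v /\ forall w, N w -> flat_at s w)) /\ s z = x.
  by move=> [N [s gs]]; exists (s z), N, s.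
(* A witness is chosen separately for each [z]; by [good_unique] the value does not depend on it, so
   [s] coincides with any single witness on all of its convex set. *)
pose s z := if pselect (good z) is left h then sval (cid (goodE z h))
  else stalk_point F z.
have sE N s' z : [/\ segment_convex N, forall w, N w -> nbhs w N, N `<=` S, N p & N z] /\
    (s' p = v /\ forall w, N w -> flat_at s' w) -> s z = s' z.
  move=> gs; rewrite /s; case: pselect => [h|]; last by case; exists N, s'.
  by case: cid => x /= [N1 [s1 [gs1 <-]]]; apply: good_unique gs1 gs.
have sP z : Y z -> s p = v /\ flat_at s z.
  move=> /gY[N [s' [[cN oN NS Np Nz] [E fs]]]].
  have ss' w : N w -> s w = s' w by move=> Nw; apply: (sE N).
  split; first by rewrite ss'.
  apply: flat_at_near (fs z Nz) _.
  by apply: filterS (oN z Nz) => w Nw; rewrite ss'.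
by exists s; [exact: (sP p Yp).1|move=> w /sP[]].
Qed.
End Star.
End Etale.

(** * Circles around the cusps *)

Section Cusps.
Variable R : realType.
Local Notation C := (R[i]^o).
Implicit Types (z w p q : C) (s a b c d : P1 R) (u th k : R).

(* The arc of the real projective line joining the two cusps other than s. *)
Definition opposite_arc s : set R :=
  if s is Some x then if x == 0 then [set u | 1 < u] else [set u | u < 0]
  else [set u | 0 < u < 1].

(** The plane cut along the two real arcs that end at [s], together with the cusps. It is
    star-shaped about every point of the remaining arc. *)
Definition slit_plane s : set C :=
  [set z | complex.Im z != 0 \/ opposite_arc s (complex.Re z)].

Lemma SlineP z : @Sline R z <-> z != 0 /\ z != 1.
Proof.
rewrite /Sline /cusps /=; split=> [h|[/eqP z0 /eqP z1] []].
- by split; apply/eqP => E; apply: h; rewrite E; [constructor 1|constructor 2].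
- by case.
- by case.
- by [].
Qed.

Lemma nbhs_Sline z : Sline z -> nbhs z (@Sline R).
Proof.
move=> /SlineP[z0 z1].
have N (x : C) : z != x -> nbhs z [set w | w != x].
  rewrite -subr_eq0 -normr_gt0 => h; apply/nbhs_ballP; exists `|z - x| => // w.
  by rewrite /ball /=; apply: contraTneq => ->; rewrite ltxx.
by apply: filterS (filterI (N _ z0) (N _ z1)) => w ?; apply/SlineP.
Qed.

Lemma eq10C : ((1 : C) == 0) = false.
Proof. exact: oner_eq0. Qed.

Lemma slit_Sline s : slit_plane s `<=` @Sline R.
Proof.
move=> z sz; apply/SlineP; split; apply/eqP => E; move: sz;
  rewrite E /slit_plane /=;
  rewrite eqxx => -[//|]; case: s => [x|] /=; try case: ifP => _ /=; lra.
Qed.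

Lemma Sline_slit z : @Sline R z -> exists2 s, cusps s & slit_plane s z.
Proof.
move=> /SlineP[z0 z1]; have [E|zi] := eqVneq (complex.Im z) 0; last first.
  by exists None; [constructor 3|left].
have r0 : complex.Re z != 0.
  by apply: contra z0 => /eqP E'; apply/eqP/complex_eqP.
have r1 : complex.Re z != 1.
  by apply: contra z1 => /eqP E'; apply/eqP/complex_eqP.
have [r|r|r] := ltrgtP (complex.Re z) 0.
- by exists (Some 1); [constructor 2|right; rewrite /= eq10C].
- have [r'|r'|r'] := ltrgtP (complex.Re z) 1.
  + by exists None; [constructor 3|right; rewrite /= r].
  + by exists (Some 0); [constructor 1|right; rewrite /= eqxx].
  + by rewrite r' eqxx in r1.
- by rewrite r eqxx in r0.
Qed.

Lemma opposite_arc_inj a b u : cusps a -> cusps b ->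
  opposite_arc a u -> opposite_arc b u -> a = b.
Proof.
by case=> -> [] -> //=; rewrite ?eqxx ?eq10C /= => *; exfalso; lra.
Qed.

Lemma slit_base s : exists2 p, complex.Im p = 0 & opposite_arc s (complex.Re p).
Proof.
case: s => [x|] /=; last by exists (2^-1)%:C%C => //=; lra.
by case: ifP => _; [exists 2%:C%C|exists (-1)%:C%C] => //=; lra.
Qed.

Lemma slit_star s p z u : complex.Im p = 0 -> opposite_arc s (complex.Re p) ->
  slit_plane s z -> 0 <= u <= 1 -> slit_plane s (seg p z u).
Proof.
move=> p0 ps sz /andP[u0 u1]; rewrite /slit_plane /= Re_seg Im_seg p0.
have [->|u0'] := eqVneq u 0; first by right; rewrite mul0r addr0.
have {}u0 : 0 < u by rewrite lt_neqAle eq_sym u0'.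
case: sz => [zi|zs]; first by left; rewrite add0r subr0 mulf_neq0.
right; move: ps zs; case: s => [x|] /=; last first.
  by move=> /andP[? ?] /andP[? ?]; apply/andP; split; nra.
by case: ifP => _ /= ? ?; nra.
Qed.

Lemma slit_open s z : slit_plane s z -> nbhs z (slit_plane s).
Proof.
move=> sz; apply/nbhs_boxP.
have [zi|zi] := eqVneq (complex.Im z) 0; last first.
  exists `|complex.Im z|; first by rewrite normr_gt0.
  by move=> w [_ h]; left; apply: contraTneq h => ->; rewrite sub0r normrN ltxx.
have [e e0 he] : exists2 e : R, 0 < e &
    forall u, `|u - complex.Re z| < e -> opposite_arc s u.
  case: sz => [|]; first by rewrite zi eqxx.
  case: s => [x|] /=; last first.
    move=> /andP[h1 h2]; exists (Num.min (complex.Re z) (1 - complex.Re z)).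
      by rewrite lt_min h1 subr_gt0.
    by move=> u; rewrite lt_min !ltr_norml; lra.
  case: ifP => _ /= h; [exists (complex.Re z - 1)|exists (- complex.Re z)];
    try lra.
    by move=> u /=; rewrite ltr_norml; lra.
  by move=> u /=; rewrite ltr_norml; lra.
by exists e => // w [h _]; right; apply: he.
Qed.

Lemma halfplane_convex (sg : R) :
  segment_convex [set z : C | 0 < sg * complex.Im z].
Proof.
move=> x y /= hx hy u /andP[u0 u1]; rewrite Im_seg.
have -> : sg * (complex.Im x + u * (complex.Im y - complex.Im x)) =
  (1 - u) * (sg * complex.Im x) + u * (sg * complex.Im y) by ring.
have [->|u1'] := eqVneq u 1; first by rewrite subrr mul0r add0r mul1r.
have {}u1 : 0 < 1 - u by rewrite subr_gt0 lt_neqAle u1'.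
by apply: ltr_pwDl; [apply: mulr_gt0|apply: mulr_ge0 => //; apply: ltW].
Qed.

(* The circle |t| = 1 / k in the local coordinate t at s. *)
Definition circle s k th : C :=
  let t : C := (cos (2 * pi * th) +i* sin (2 * pi * th))%C / k%:C%C in
  if s is Some x then x + t else t^-1.

Lemma loop_circle s : loop s = circle s 2.
Proof. by apply/funext => th; rewrite /loop /circle rmorph_nat. Qed.

Lemma circle_Some (x : C) k th : circle (Some x) k th =
  ((complex.Re x + cos (2 * pi * th) / k)
    +i* (complex.Im x + sin (2 * pi * th) / k))%C.
Proof.
rewrite /circle -fmorphV; case: x => x1 x2 /=.
by apply: complex_eqP => /=; rewrite ?mulr0 ?subr0 ?add0r.
Qed.

Lemma circle_None k th : k != 0 -> circle None k th =
  ((k * cos (2 * pi * th)) -i* (k * sin (2 * pi * th)))%C.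
Proof.
move=> k0; rewrite /circle -fmorphV; apply: mulr1_eq.
have := cos2Dsin2 (2 * pi * th); set x := cos _; set y := sin _ => xy.
by apply: complex_eqP; rewrite /= ?mulr0 ?subr0 ?add0r; [rewrite -xy|]; field.
Qed.

Lemma continuous_circle s k : k != 0 -> continuous (circle s k).
Proof.
move=> k0.
have cc : continuous (fun th : R => cos (2 * pi * th)).
  by move=> u; apply: continuous_comp; [apply: cvgM;
    [exact: cvg_cst|exact: cvg_id]|exact: continuous_cos].
have cs : continuous (fun th : R => sin (2 * pi * th)).
  by move=> u; apply: continuous_comp; [apply: cvgM;
    [exact: cvg_cst|exact: cvg_id]|exact: continuous_sin].
case: s => [x|] th.
  have -> : circle (Some x) k = fun th => ((complex.Re x + cos (2 * pi * th) / k)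
    +i* (complex.Im x + sin (2 * pi * th) / k))%C.
    by apply/funext => u; rewrite circle_Some.
  by apply: cvg_complex => /=; apply: cvgD; (try exact: cvg_cst);
    apply: cvgM; (try exact: cvg_cst); [exact: cc|exact: cs].
have -> : circle None k = fun th => ((k * cos (2 * pi * th)) -i* (k * sin (2 * pi * th)))%C.
  by apply/funext => u; rewrite circle_None.
by apply: cvg_complex => /=; [|apply: cvgN]; apply: cvgM; (try exact: cvg_cst);
  [exact: cc|exact: cs].
Qed.

Lemma sin_turn_gt0 th : 0 < th < 2^-1 -> 0 < sin (2 * pi * th).
Proof. by move=> h; apply: sin_gt0_pi; have := pi_gt0 R; case/andP: h => *;
  apply/andP; split; nra. Qed.

Lemma sin_turn_lt0 th : 2^-1 < th < 1 -> sin (2 * pi * th) < 0.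
Proof.
move=> h; have -> : 2 * pi * th = 2 * pi * (th - 2^-1) + pi :> R by field.
by rewrite sinDpi oppr_lt0; apply: sin_turn_gt0; lra.
Qed.

(** The circle crosses the real line at the start, opposite to [b], and at half a turn, opposite to
    [c]; in between it stays in one half-plane, then in the other. The factor [sg] is scaled so that
    its product with the imaginary part is the sine; it is negative at infinity, where the
    coordinate 1/z reverses the orientation. *)
Lemma circle_spec a k : cusps a -> 1 < k -> exists b c (sg : R),
  [/\ cusps b, cusps c, b <> a, c <> a & b <> c] /\
  [/\ forall d, cusps d -> d <> a -> d = b \/ d = c,
      complex.Im (circle a k 0) = 0 /\ opposite_arc b (complex.Re (circle a k 0)),
      complex.Im (circle a k 2^-1) = 0 /\
        opposite_arc c (complex.Re (circle a k 2^-1)),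
      forall th, 0 < th < 2^-1 -> 0 < sg * complex.Im (circle a k th) &
      forall th, 2^-1 < th < 1 -> 0 < - sg * complex.Im (circle a k th)] /\
  circle a k 1 = circle a k 0.
Proof.
move=> ca k1; have k0 : 0 < k by lra.
have kn0 : k != 0 by rewrite gt_eqF.
have sc0 : (sin (2 * pi * 0) = 0 :> R) * (cos (2 * pi * 0) = 1 :> R).
  by rewrite mulr0 sin0 cos0.
have sc1 : (sin (2 * pi * 1) = 0 :> R) * (cos (2 * pi * 1) = 1 :> R).
  by rewrite mulr1 mulr_natl sin2pi cos2pi.
have sch : (sin (2 * pi * 2^-1) = 0 :> R) * (cos (2 * pi * 2^-1) = -1 :> R).
  by rewrite mulrAC divff // mul1r sinpi cospi.
have ki : 0 < k^-1 < 1 by rewrite invr_gt0 k0 invf_lt1.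
have s_up (sg h : R) : 0 < h -> h * sg = 1 -> forall th,
    (0 < th < 2^-1 -> 0 < sg * (0 + h * sin (2 * pi * th))) /\
    (2^-1 < th < 1 -> 0 < - sg * (0 + h * sin (2 * pi * th))).
  move=> h0 E th; rewrite add0r !mulrA mulNr ![sg * _]mulrC E mul1r mulN1r oppr_gt0.
  by split; [exact: sin_turn_gt0|exact: sin_turn_lt0].
have sSome x th : complex.Im x = 0 -> complex.Im (circle (Some x) k th) = 0 + k^-1 * sin (2 * pi * th).
  by move=> x0; rewrite circle_Some /= x0 mulrC.
have sNone th : complex.Im (circle None k th) = 0 + (- k) * sin (2 * pi * th).
  by rewrite circle_None //= add0r mulNr.
have rSome x th : complex.Re (circle (Some x) k th) = complex.Re x + k^-1 * cos (2 * pi * th).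
  by rewrite circle_Some /= mulrC.
have rNone th : complex.Re (circle None k th) = k * cos (2 * pi * th).
  by rewrite circle_None.
have per s : circle s k 1 = circle s k 0.
  by case: s => [x|]; rewrite ?circle_Some ?circle_None // !(sc0, sc1).
case: ca => ->.
- exists None, (Some 1), k; split; first by split=> //;
    [constructor 3|constructor 2|case=> /eqP; rewrite oner_eq0].
  split=> //; rewrite !sSome // !rSome !(sc0, sch) /opposite_arc eq10C.
  split; try by move=> th; rewrite sSome //; have [] := @s_up k k^-1 _ _ th;
    rewrite ?invr_gt0 ?mulVf.
  + by move=> d [] -> //; [right|left].
  + by rewrite /= mulr0 addr0; split => //; lra.
  + by rewrite /= mulr0 addr0; split => //; lra.
- exists (Some 0), None, k; split; first by split=> //;
    [constructor 1|constructor 3|case=> /eqP; rewrite eq_sym oner_eq0].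
  split=> //; rewrite !sSome // !rSome !(sc0, sch) /opposite_arc eqxx.
  split; try by move=> th; rewrite sSome //; have [] := @s_up k k^-1 _ _ th;
    rewrite ?invr_gt0 ?mulVf.
  + by move=> d [] -> //; [left|right].
  + by rewrite /= mulr0 addr0; split => //; lra.
  + by rewrite /= mulr0 addr0; split => //; lra.
- exists (Some 0), (Some 1), (- k^-1); split; first by split=> //;
    [constructor 1|constructor 2|case=> /eqP; rewrite eq_sym oner_eq0].
  split=> //; rewrite !sNone !rNone !(sc0, sch) /opposite_arc eqxx eq10C.
  split.
  + by move=> d [] -> //; [left|right].
  + by rewrite /= mulr0 addr0; split => //; lra.
  + by rewrite /= mulr0 addr0; split => //; lra.
  + move=> th h; rewrite sNone add0r mulrA mulrNN mulVf // mul1r;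
      exact: sin_turn_gt0.
  + move=> th h; rewrite sNone add0r opprK mulrA mulrN mulVf // mulN1r oppr_gt0;
      exact: sin_turn_lt0.
Qed.

End Cusps.

(** * Extension and gluing of flat sections *)

Section Extension.
Variable R : realType.
Local Notation C := (R[i]^o).
Variable F : etale_space (@Sline R).
Implicit Types (z w p q : C) (a b c d : P1 R) (s t : forall z, F z).

(** The slit planes of the two other cusps together make up [Sline] cut along the single arc
    opposite to [a]. *)
Definition flat_off a s :=
  forall b, cusps b -> b <> a -> forall z, slit_plane b z -> flat_at s z.

Lemma slit_section b p (v : F p) :
  complex.Im p = 0 -> opposite_arc b (complex.Re p) ->
  exists2 s, s p = v & forall z, slit_plane b z -> flat_at s z.
Proof.
move=> p0 bp; apply: flat_section_star; first by right.
by move=> z bz u u01; apply: (@slit_Sline _ b); apply: slit_star.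
Qed.

(** Agreement at [q] is carried along one ray to the centre of the star and from there along another
    ray to [z]. *)
Lemma slit_unique b s t q : (forall z, slit_plane b z -> flat_at s z) ->
  (forall z, slit_plane b z -> flat_at t z) -> slit_plane b q -> s q = t q ->
  forall z, slit_plane b z -> s z = t z.
Proof.
move=> bs bt bq E; have [p p0 bp] := slit_base b.
have st z (u : R) : slit_plane b z -> 0 <= u <= 1 ->
    [/\ Sline (seg p z u), flat_at s (seg p z u) & flat_at t (seg p z u)].
  move=> bz u01; have := slit_star p0 bp bz u01.
  by move=> h; split; [exact: slit_Sline h|exact: bs|exact: bt].
move=> z bz; apply: (@seg_unique _ _ _ _ _ p); first by move=> u; apply: st.
apply: (@seg_unique _ _ _ _ _ q) => // u u01.
have -> : seg q p u = seg p q (1 - u).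
  by apply: complex_eqP; rewrite ?Re_seg ?Im_seg; ring.
by apply: st => //; lra.
Qed.

(** Opposite arcs of distinct cusps are disjoint, so the slit plane of [b] meets those of [D]
    exactly in the two open half-planes. These are convex, hence one point of agreement in each is
    enough. *)
Lemma slit_glue b (D : set (P1 R)) c s t (sg : R) z1 z2 :
  cusps b -> D `<=` @cusps R -> ~ D b -> D c ->
  (forall z, slit_plane b z -> flat_at s z) ->
  (forall d, D d -> forall z, slit_plane d z -> flat_at t z) ->
  0 < sg * complex.Im z1 -> s z1 = t z1 ->
  0 < - sg * complex.Im z2 -> s z2 = t z2 ->
  exists r, [/\ forall z, slit_plane b z -> r z = s z,
    forall d, D d -> forall z, slit_plane d z -> r z = t z &
    forall d, d = b \/ D d -> forall z, slit_plane d z -> flat_at r z].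
Proof.
move=> cb Dc Db Dc0 bs Dt z1p E1 z2p E2.
have half (g : R) p : 0 < g * complex.Im p -> s p = t p ->
    forall z, 0 < g * complex.Im z -> s z = t z.
  have ne z : 0 < g * complex.Im z -> forall d, slit_plane d z.
    by move=> h d; left; apply: contraTneq h => ->; rewrite mulr0 ltxx.
  move=> gp E z gz; apply: (convex_unique (@halfplane_convex _ g) _ _ gp E) => //.
    by move=> w /ne/(_ b)/slit_Sline.
  by move=> w /ne h; split; [exact: bs|exact: Dt (h c)].
have st d z : D d -> slit_plane b z -> slit_plane d z -> s z = t z.
  move=> Dd bz dz; have [z0|z0] := eqVneq (complex.Im z) 0.
    case: bz dz => [|h]; rewrite ?z0 ?eqxx // => -[|h']; rewrite ?z0 ?eqxx //.
    by case: Db; rewrite (opposite_arc_inj cb (Dc _ Dd) h h').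
  have g0 : sg != 0 by apply: contraTneq z1p => ->; rewrite mul0r ltxx.
  have [h|h|h] := ltrgtP (sg * complex.Im z) 0.
  - by apply: (half _ _ z2p E2); rewrite mulNr oppr_gt0.
  - exact: (half _ _ z1p E1).
  - by move/eqP: h; rewrite mulf_eq0 (negPf g0) (negPf z0).
exists (fun z => if pselect (slit_plane b z) then s z else t z); split.
- by move=> z ?; case: pselect.
- by move=> d Dd z dz; case: pselect => // h; exact: (st d).
move=> d bD z dz; apply: (@flat_glue _ _ _ (slit_plane b) [set w | exists2 d, D d & slit_plane d w]).
- have [h|h] := pselect (slit_plane b z); [left; exact: slit_open|right;
    split => //].
  case: bD => [bD|Dd]; first by rewrite bD in dz.
  by apply: filterS (slit_open dz) => w ?; exists d.
- by move=> /nbhs_singleton/bs.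
- by move=> /nbhs_singleton[d' /Dt]; apply.
- by move=> _; apply: filterE => w ? [d' ? ?]; exact: (st d').
Qed.

(* A closed flat path over the circle around a meets the real line in the arcs
   opposite to the other two cusps; the sections on the two slit planes through
   these points agree on both half-planes. *)
Lemma circle_extension a (k : R) (rho : R -> {z : C & F z}) : cusps a -> 1 < k ->
  flat_along (circle a k) rho 0 1 -> rho 0 = rho 1 ->
  exists2 s, flat_off a s & rho 0 = existT F (circle a k 0) (s (circle a k 0)).
Proof.
move=> ca k1 rhoF rho01; set g := circle a k.
have gc : continuous g by apply: continuous_circle; lra.
have [b [c [sg [[cb cc ba ca' bc] [[abc [g0 bg0] [gh cgh] up low] g01]]]]] :=
  circle_spec ca k1.
have rhoE u : 0 <= u <= 1 -> exists v, rho u = existT F (g u) v.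
  move=> u01; have [s _ /nbhs_singleton/(_ u01) ->] := rhoF u u01.
  by exists (s (g u)).
have [|v0 E0] := rhoE 0; first by rewrite lexx ler01.
have [|vh Eh] := rhoE 2^-1; first by lra.
have [s sE bs] := slit_section v0 g0 bg0.
have [t tE ct] := slit_section vh gh cgh.
have uplow (th : R) : 0 < th < 2^-1 \/ 2^-1 < th < 1 -> complex.Im (g th) != 0.
  by case=> [/up|/low] h; apply: contraTneq h => ->; rewrite mulr0 ltxx.
(* The circle leaves the slit plane of [b] only at half a turn, and that of [c] only at its two
   ends. So [rho] follows [s] from either end up to half a turn, and [t] in between. *)
have bg (th : R) : 0 <= th < 2^-1 \/ 2^-1 < th <= 1 -> slit_plane b (g th).
  have [->|h0] := eqVneq th 0; first by right.
  have [->|h1] := eqVneq th 1; first by right; rewrite /g g01.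
  move=> h; left; apply: uplow; rewrite !lt_neqAle [0 == _]eq_sym h0 h1 /=;
    case: h; lra.
have cg (th : R) : 0 < th < 1 -> slit_plane c (g th).
  have [->|] := eqVneq th 2^-1; first by right.
  by rewrite neq_lt => /orP hh h; left; apply: uplow; case: hh; [left|right]; lra.
have rs (x y th : R) : (0 <= x /\ y < 2^-1) \/ (2^-1 < x /\ y <= 1) ->
    forall th', x <= th <= y -> x <= th' <= y ->
    rho th = existT F (g th) (s (g th)) -> rho th' = existT F (g th') (s (g th')).
  move=> xy th' h h'; apply: (@flat_along_unique _ _ _ _ _ _ x y) => //.
    by apply: flat_along_sub rhoF; case: xy; lra.
  by move=> u uxy; have bu : slit_plane b (g u);
    [apply: bg; case: xy; lra|split; [exact: slit_Sline bu|exact: bs]].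
have rt (x y th : R) : 0 < x -> y < 1 ->
    forall th', x <= th <= y -> x <= th' <= y ->
    rho th = existT F (g th) (t (g th)) -> rho th' = existT F (g th') (t (g th')).
  move=> x0 y1 th' h h'; apply: (@flat_along_unique _ _ _ _ _ _ x y) => //.
    by apply: flat_along_sub rhoF; lra.
  by move=> u uxy; have cu : slit_plane c (g u);
    [apply: cg; lra|split; [exact: slit_Sline cu|exact: ct]].
have s0 : rho 0 = existT F (g 0) (s (g 0)) by rewrite E0 sE.
have s1 : rho 1 = existT F (g 1) (s (g 1)) by rewrite -rho01 s0 /g g01.
have th : rho 2^-1 = existT F (g 2^-1) (t (g 2^-1)) by rewrite Eh tE.
(* One time in each half-plane. At [y] the path is traced back from time 1, where [rho 0 = rho 1]
   puts it on [s]. *)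
pose x : R := 4^-1; pose y : R := 1 - 4^-1.
have Ex : s (g x) = t (g x).
  have sx : rho x = existT F (g x) (s (g x)).
    by apply: (@rs 0 x 0 _ x _ _ s0); rewrite /x; [left|..]; lra.
  have tx : rho x = existT F (g x) (t (g x)).
    by apply: (@rt x 2^-1 2^-1 _ _ x _ _ th); rewrite /x; lra.
  by apply: total_inj; rewrite -sx tx.
have Ey : s (g y) = t (g y).
  have sy : rho y = existT F (g y) (s (g y)).
    by apply: (@rs y 1 1 _ y _ _ s1); rewrite /y; [right|..]; lra.
  have ty : rho y = existT F (g y) (t (g y)).
    by apply: (@rt 2^-1 y 2^-1 _ _ y _ _ th); rewrite /y; lra.
  by apply: total_inj; rewrite -sy ty.
have [||||||r [rb _ rF]] := @slit_glue b [set c] c s t sg (g x) (g y) cb _ _ _ bs _ _ Ex _ Ey.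
- by move=> _ ->.
- exact: bc.
- by [].
- by move=> _ ->.
- by apply: up; rewrite /x; lra.
- by apply: low; rewrite /y; lra.
exists r.
  by move=> d cd da z dz; apply: (rF d) => //; exact: abc.
by rewrite -/g s0 rb //; apply: bg; left; lra.
Qed.

(** The two cut domains cover [Sline] and meet in the slit plane of [c], which is connected; so
    equality at [q] spreads over the overlap, in particular to the two test points ['i] and its
    negative. *)
Lemma cusp_glue a b c s t q : cusps a -> cusps b -> cusps c ->
  a <> b -> a <> c -> b <> c ->
  (forall d, cusps d -> [\/ d = a, d = b | d = c]) ->
  flat_off a s -> flat_off b t -> slit_plane c q -> s q = t q ->
  exists2 r, forall z, Sline z -> flat_at r z &
    forall z, slit_plane c z -> r z = s z /\ r z = t z.
Proof.
move=> ca cb cc ab ac bc abc fs ft cq E.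
have cst z : slit_plane c z -> s z = t z.
  exact: (slit_unique (fs c cc (nesym ac)) (ft c cc (nesym bc)) cq E).
have i1 : (0 : R) < 1 * complex.Im ('i%C : C) by rewrite mul1r.
have i2 : (0 : R) < - 1 * complex.Im (- 'i%C : C) by rewrite mulN1r /= opprK.
have Ei1 : s 'i%C = t 'i%C by apply: cst; left; rewrite /= oner_neq0.
have Ei2 : s (- 'i%C) = t (- 'i%C) by apply: cst; left;
  rewrite /= oppr_eq0 oner_neq0.
have [||||r [rb rac rF]] := @slit_glue b [set d | d = a \/ d = c] c s t 1 _ _ cb _ _ _
    (fs b cb (nesym ab)) _ i1 Ei1 i2 Ei2.
- by move=> d [] ->.
- by case=> ?; [apply: ab|apply: bc].
- by right.
- by move=> d [] ->; apply: ft => //; apply: nesym.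
exists r.
  move=> z /Sline_slit[d /abc dabc dz]; apply: rF dz.
  by case: dabc; [right; left|left|right; right].
by move=> z cz; rewrite -(cst z cz) (cst z cz) (rac c) //; right.
Qed.
End Extension.

(** * Local systems and torsors *)

Section LocalSystem.
Variables (R : realType) (n : nat) (V : local_system R n).
Local Notation C := (R[i]^o).
Implicit Types (s t : sec V) (z w p q : C) (a b c d : P1 R).

Definition sec_flat_at s z := forall W (e : forall z, n.-tuple (V z)),
  atlas W e -> W z -> forall i,
  \forall w \near z, coord (e w) i (s w) = coord (e z) i (s z).

Lemma near_forall2 z (P Q : 'I_n -> C -> Prop) :
  (forall i, \forall w \near z, P i w) -> (forall i, \forall w \near z, Q i w) ->
  \forall w \near z, forall i, P i w /\ Q i w.
Proof.
by move=> hP hQ; exact: (filter_forall _ (fun i => filterI (hP i) (hQ i))).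
Qed.

Lemma flatE U s : flat U s <-> forall z, U z -> sec_flat_at s z.
Proof.
split=> [h z Uz W e We Wz i|h W e We i z [Uz Wz]]; first exact: (h W e We i z).
exact: (h z Uz W e We Wz i).
Qed.

Lemma nbhs_atlas W (e : forall z, n.-tuple (V z)) z :
  atlas W e -> W z -> nbhs z W.
Proof. by move=> /atlas_open[oW _] Wz; apply: open_nbhs_nbhs; split. Qed.

Lemma atlas_coordP W (e : forall z, n.-tuple (V z)) z (u v : V z) :
  atlas W e -> W z -> (forall i, coord (e z) i u = coord (e z) i v) -> u = v.
Proof.
move=> We Wz uv; have bz := atlas_basis We Wz.
rewrite (coord_basis bz (memvf u)) (coord_basis bz (memvf v)).
by apply: eq_bigr => i _; rewrite uv.
Qed.

Lemma atlas_coord_sum W (e : forall z, n.-tuple (V z)) z (k : 'I_n -> R[i]) i :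
  atlas W e -> W z -> coord (e z) i (\sum_j k j *: tnth (e z) j) = k i.
Proof.
move=> We Wz; have /basis_free fz := atlas_basis We Wz.
rewrite -(coord_sum_free k i fz); congr coord.
by apply: eq_bigr => j _; rewrite (tnth_nth 0).
Qed.

(** One frame decides: coordinates in any other frame come from these by a transition matrix that is
    constant near [z]. *)
Lemma sec_flat_at_frame W (e : forall z, n.-tuple (V z)) s z :
  atlas W e -> W z ->
  (forall i, \forall w \near z, coord (e w) i (s w) = coord (e z) i (s z)) ->
  sec_flat_at s z.
Proof.
move=> We Wz h W' e' We' Wz' i.
have near_all := near_forall2 h (fun j =>
  @atlas_compat _ _ V _ _ _ _ We' We i j z (conj Wz' Wz)).
apply: filterS (filterI near_all (nbhs_atlas We Wz)) => w [hw Ww].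
have exp x : W x -> s x = \sum_j coord (e x) j (s x) *: tnth (e x) j.
  move=> Wx; rewrite {1}(coord_basis (atlas_basis We Wx) (memvf (s x))).
  by apply: eq_bigr => j _; rewrite (tnth_nth 0).
rewrite (exp w Ww) (exp z Wz) !linear_sum; apply: eq_bigr => j _.
by rewrite !linearZ /=; have [-> ->] := hw j.
Qed.

Lemma sec_flat_at_near s t z : sec_flat_at s z ->
  (\forall w \near z, s w = t w) -> sec_flat_at t z.
Proof.
move=> fs st W e We Wz i; have zst := nbhs_singleton st.
by apply: filterS (filterI (fs W e We Wz i) st) => w [h <-]; rewrite h zst.
Qed.

Lemma sec_flat_at_eq s t z : Sline z -> sec_flat_at s z -> sec_flat_at t z ->
  \forall w \near z, s w = t w <-> s z = t z.
Proof.
move=> /(atlas_cover V)[W [e [We Wz]]] fs ft.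
have h := near_forall2 (fs W e We Wz) (ft W e We Wz).
apply: filterS (filterI h (nbhs_atlas We Wz)) => w [hw Ww].
split=> E.
  by apply: (atlas_coordP We Wz) => i; have [<- <-] := hw i; rewrite E.
by apply: (atlas_coordP We Ww) => i; have [-> ->] := hw i; rewrite E.
Qed.

Lemma frame_sec_flat_at W (e : forall z, n.-tuple (V z)) (k : 'I_n -> R[i]) z :
  atlas W e -> W z -> sec_flat_at (fun x => \sum_i k i *: tnth (e x) i) z.
Proof.
move=> We Wz; apply: (sec_flat_at_frame We Wz) => i.
apply: filterS (nbhs_atlas We Wz) => w Ww.
by rewrite (atlas_coord_sum _ _ We Wz) (atlas_coord_sum _ _ We Ww).
Qed.

Lemma sec_flat_at_ext z : Sline z -> exists B, [/\ nbhs z B, B `<=` @Sline R &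
  forall w (v : V w), B w ->
    exists2 s, s w = v & forall x, B x -> sec_flat_at s x].
Proof.
move=> /(atlas_cover V)[W [e [We Wz]]]; exists W; split.
- exact: nbhs_atlas We Wz.
- by have [] := atlas_open We.
move=> w v Ww; exists (fun x => \sum_i coord (e w) i v *: tnth (e x) i).
  by apply: (atlas_coordP We Ww) => i; rewrite (atlas_coord_sum _ _ We Ww).
by move=> x Wx; apply: frame_sec_flat_at We Wx.
Qed.

Lemma sec_flat_at_lin (k : R[i]) s t z : sec_flat_at s z -> sec_flat_at t z ->
  sec_flat_at (fun w => k *: s w + t w) z.
Proof.
move=> fs ft W e We Wz i.
apply: filterS (filterI (fs W e We Wz i) (ft W e We Wz i)) => w [h h'].
by rewrite !linearD !linearZ /= h h'.
Qed.

Definition ls_etale : etale_space (@Sline R) :=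
  @EtaleSpace R (@Sline R) (fun z => V z) (fun=> 0) sec_flat_at
    sec_flat_at_near sec_flat_at_eq sec_flat_at_ext.

Lemma sec_flat_at0 z : sec_flat_at (fun=> 0) z.
Proof. by move=> W e We Wz i; apply: filterE => w; rewrite !linear0. Qed.

Lemma sec_flat_atD s t z : sec_flat_at s z -> sec_flat_at t z ->
  sec_flat_at (fun w => s w + t w) z.
Proof.
move=> fs ft; apply: sec_flat_at_near (sec_flat_at_lin 1 fs ft) _.
by apply: filterE => w; rewrite scale1r.
Qed.

Lemma sec_flat_atZ (k : R[i]) s z : sec_flat_at s z ->
  sec_flat_at (fun w => k *: s w) z.
Proof.
move=> fs; apply: sec_flat_at_near (sec_flat_at_lin k fs (@sec_flat_at0 z)) _.
by apply: filterE => w; rewrite addr0.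
Qed.

(** * The torsor of a Cech cocycle *)

Section Torsor.
Variables (U : P1 R -> set (P1 R)) (cc : cochain1 V).
Hypotheses (Uc : pointed_cover U)
  (cF : forall x y, jstar (U x `&` U y) (cc x y))
  (cD : forall x y x' z, trace (U x `&` U y `&` U x') z ->
     cc x x' z = cc x y z + cc y x' z).

(* A point z of S indexes the open set U (Some z); the value at z of a section s
   of the torsor of cc is its component in that chart. *)
Definition torsor_flat_at s z := forall x, U x (Some z) ->
  sec_flat_at (fun w => s w + cc (Some w) x w) z.

Lemma nbhs_trace (O : set (P1 R)) z : open O -> O (Some z) -> Sline z -> nbhs z (trace O).
Proof.
move=> oO Oz Sz; have : nbhs (Some z : P1 R) O by apply: open_nbhs_nbhs; split.
move=> /one_point_compactification_some_continuous h.
by apply: filterS (filterI (nbhs_Sline Sz) h) => w [].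
Qed.

Lemma nbhs_cover x z : U x (Some z) -> Sline z -> nbhs z (trace (U x)).
Proof. by have [oU _] := Uc x; apply: nbhs_trace. Qed.

Lemma cover_self z : U (Some z) (Some z).
Proof. by have [] := Uc (Some z). Qed.

(** A flat section of [V] read in the chart [x] becomes, in a chart [y], the section [s + cc x y] by
    the cocycle relation, and [cc x y] is flat. *)
Lemma torsor_flat_at_chart x s z : Sline z -> U x (Some z) -> sec_flat_at s z ->
  torsor_flat_at (fun w => s w - cc (Some w) x w) z.
Proof.
move=> Sz xz fs y yz.
have cz : sec_flat_at (cc x y) z by have /flatE := @cF x y; apply; split.
apply: sec_flat_at_near (sec_flat_atD fs cz) _.
apply: filterS (filterI (nbhs_cover xz Sz) (nbhs_cover yz Sz)) => w [[Sw xw] [_ yw]].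
have -> : cc (Some w) y w = cc (Some w) x w + cc x y w.
  by apply: cD; split => //; split => //; split => //; apply: cover_self.
by rewrite addrA subrK.
Qed.

Lemma torsor_flat_at_near s t z : torsor_flat_at s z ->
  (\forall w \near z, s w = t w) -> torsor_flat_at t z.
Proof.
move=> fs st x xz; apply: sec_flat_at_near (fs x xz) _.
by apply: filterS st => w ->.
Qed.

Lemma torsor_flat_at_eq s t z : Sline z ->
  torsor_flat_at s z -> torsor_flat_at t z ->
  \forall w \near z, s w = t w <-> s z = t z.
Proof.
move=> Sz /(_ _ (cover_self z)) fs /(_ _ (cover_self z)) ft.
have := sec_flat_at_eq Sz fs ft; apply: filterS => w [h1 h2].
split=> E; first by apply: (addIr _ (h1 _)); rewrite E.
by apply: (addIr _ (h2 _)); rewrite E.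
Qed.

Lemma torsor_flat_at_ext z : Sline z -> exists B, [/\ nbhs z B, B `<=` @Sline R &
  forall w (v : V w), B w ->
    exists2 s : sec V, s w = v & forall x, B x -> torsor_flat_at s x].
Proof.
move=> Sz; have [B [zB BS Bext]] := sec_flat_at_ext Sz.
exists (B `&` trace (U (Some z))); split.
- by apply: filterI => //; apply: nbhs_cover => //; apply: cover_self.
- by move=> w [/BS].
move=> w v [Bw [_ Uw]].
have [s sE sF] := Bext w (v + cc (Some w) (Some z) w) Bw.
exists (fun x => s x - cc (Some x) (Some z) x); first by rewrite sE addrK.
by move=> x [Bx [Sx zx]]; apply: torsor_flat_at_chart => //; apply: sF.
Qed.

Definition torsor_etale : etale_space (@Sline R) :=
  @EtaleSpace R (@Sline R) (fun z => V z) (fun=> 0) torsor_flat_at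
    torsor_flat_at_near torsor_flat_at_eq torsor_flat_at_ext.

Lemma torsor_flat_atD s t z : torsor_flat_at s z -> sec_flat_at t z ->
  torsor_flat_at (fun w => s w + t w) z.
Proof.
move=> fs ft x xz; apply: sec_flat_at_near (sec_flat_atD (fs x xz) ft) _.
by apply: filterE => w; rewrite addrAC.
Qed.

(** The components of a global section in the charts form a 0-cochain whose differences are [cc]. *)
Lemma torsor_coboundary s : (forall z, Sline z -> torsor_flat_at s z) ->
  coboundary cc.
Proof.
move=> fs; exists U, (fun x w => s w + cc (Some w) x w); split => //.
  by move=> x; apply/flatE => z [Sz xz]; apply: fs.
move=> x y z [Sz [xz yz]].
have -> : cc (Some z) y z = cc (Some z) x z + cc x y z.
  by apply: cD; split => //; split => //; split => //; apply: cover_self.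
by rewrite opprD addrACA subrr add0r addrAC subrr add0r.
Qed.

(** This is the zero section of the chart [x], the source of flat torsor sections near a cusp. *)
Lemma torsor_chart_flat x z : Sline z -> U x (Some z) ->
  torsor_flat_at (fun w => cc x (Some w) w) z.
Proof.
move=> Sz xz; apply: torsor_flat_at_near (torsor_flat_at_chart Sz xz (@sec_flat_at0 z)) _.
apply: filterS (nbhs_cover xz Sz) => w [Sw xw]; rewrite sub0r.
have Uw := cover_self w.
(* The cocycle relation makes the diagonal terms vanish and then gives antisymmetry. *)
have E1 : cc (Some w) (Some w) w = cc (Some w) (Some w) w + cc (Some w) (Some w) w.
  by apply: cD.
have E2 : cc (Some w) (Some w) w = cc (Some w) x w + cc x (Some w) w by apply: cD.
apply/esym/eqP; rewrite -addr_eq0 addrC -E2; apply/eqP.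
by apply: (addrI (cc (Some w) (Some w) w)); rewrite -E1 addr0.
Qed.

End Torsor.
End LocalSystem.

(** * Monodromy *)

Section Circles.
Variable R : realType.
Local Notation C := (R[i]^o).
Implicit Types (z w : C) (a b c d : P1 R) (k th : R).

Lemma continuous_Re : continuous (fun z => complex.Re z : R).
Proof.
move=> z P /nbhs_ballP[e /= e0 eP]; apply/nbhs_boxP; exists e => // w [h _].
by apply: eP; rewrite /ball /= distrC.
Qed.

Lemma continuous_Im : continuous (fun z => complex.Im z : R).
Proof.
move=> z P /nbhs_ballP[e /= e0 eP]; apply/nbhs_boxP; exists e => // w [_ h].
by apply: eP; rewrite /ball /= distrC.
Qed.

Lemma circle_near a (O : set (P1 R)) : open O -> O a ->
  exists2 k, 1 < k & forall th, O (Some (circle a k th)).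
Proof.
move=> oO Oa; have : nbhs a O by apply: open_nbhs_nbhs; split.
case: a Oa => [x|] Oa.
  move=> /one_point_compactification_some_continuous/nbhs_boxP[e e0 eO].
  have ei : 0 < e^-1 by rewrite invr_gt0.
  have k1 : 1 < 1 + e^-1 by lra.
  exists (1 + e^-1) => // th; apply: eO.
  have ke : (1 + e^-1)^-1 < e.
    by rewrite invf_plt ?posrE //; lra.
  have k0 : 0 <= (1 + e^-1)^-1 by rewrite invr_ge0; lra.
  have small (u : R) : -1 <= u <= 1 -> `|u / (1 + e^-1)| < e.
    move=> u1; rewrite normrM (ger0_norm k0); apply: le_lt_trans ke.
    by rewrite ler_piMl // ler_norml.
  rewrite circle_Some; split => /=; rewrite addrAC subrr add0r; apply: small.
    by rewrite cos_geN1 cos_le1.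
  by rewrite sin_geN1 sin_le1.
move=> [K [cK _] KO].
have bound (f : C -> R) : continuous f -> exists M : R, forall z, K z -> forall r, M < r -> `|f z| <= r.
  move=> cf; have /compact_bounded[M [_ HM]] : compact (f @` K).
    by apply: continuous_compact => //; apply: continuous_subspaceT.
  by exists M => z Kz r Mr; apply: (HM r Mr); exists z.
have [M HM] := bound _ continuous_Re; have [N HN] := bound _ continuous_Im.
(* On the compact set [K] both coordinates are at most [r] in absolute value, so the squared modulus
   is at most 2r^2, less than the 4r^2 on the circle of radius [2 * r]. *)
pose r := 1 + `|M| + `|N|.
have [M0 N0] : 0 <= `|M| /\ 0 <= `|N| by split; apply: normr_ge0.
exists (2 * r) => [|th]; first by rewrite /r; lra.
apply: KO; left; exists (circle None (2 * r) th) => // Kc.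
have r0 : 1 <= r by rewrite /r; lra.
have k0 : 2 * r != 0 by rewrite gt_eqF //; lra.
have Mr : M < r by rewrite /r; have := ler_norm M; lra.
have Nr : N < r by rewrite /r; have := ler_norm N; lra.
have sq (u : R) : `|u| <= r -> u ^+ 2 <= r ^+ 2.
  by rewrite ler_norml => /andP[h1 h2]; nra.
have := sq _ (HM _ Kc r Mr); have := sq _ (HN _ Kc r Nr).
rewrite circle_None //= sqrrN !exprMn; have := cos2Dsin2 (2 * pi * th).
by set x := cos _ ^+ 2; set y := sin _ ^+ 2 => xy hx hy; nra.
Qed.

Lemma circle_Sline a k th : cusps a -> 1 < k -> 0 <= th <= 1 ->
  Sline (circle a k th).
Proof.
move=> ca k1 h.
have [b [c [sg [_ [[_ [_ b0] [_ ch] up low] per]]]]] := circle_spec ca k1.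
have [->|] := eqVneq th 0; first by apply: (@slit_Sline _ b); right.
rewrite neq_lt => /orP[|h0]; first by lra.
have [->|] := eqVneq th 1; first by rewrite per; apply: (@slit_Sline _ b); right.
rewrite neq_lt => /orP[h1|]; last by lra.
have [->|] := eqVneq th 2^-1; first by apply: (@slit_Sline _ c); right.
rewrite neq_lt => /orP hh; apply: (@slit_Sline _ b); left.
suff [g g0] : exists g, 0 < g * complex.Im (circle a k th).
  by apply: contraTneq g0 => ->; rewrite mulr0 ltxx.
case: hh => hh; first by exists sg; apply: up; lra.
by exists (- sg); apply: low; lra.
Qed.

Lemma circle0_slit a k : cusps a -> 1 < k ->
  exists b, [/\ cusps b, b <> a & slit_plane b (circle a k 0)].
Proof.
move=> ca k1; have [b [c [sg [[cb _ ba _ _] [[_ [_ b0] _ _ _] _]]]]] := circle_spec ca k1.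
by exists b; split => //; right.
Qed.

Lemma circle1 a k : cusps a -> 1 < k -> circle a k 1 = circle a k 0.
Proof. by move=> ca k1; have [? [? [? [_ [_ ->]]]]] := circle_spec ca k1. Qed.

Lemma other_cusps c : cusps c -> exists a b,
  [/\ cusps a, cusps b, a <> b, a <> c & b <> c] /\
  forall d, cusps d -> [\/ d = a, d = b | d = c].
Proof.
have n01 : (Some 0 : P1 R) <> Some 1 by case=> /eqP; rewrite eq_sym oner_eq0.
have n10 := nesym n01.
case=> ->.
- exists (Some 1), None; split; last by move=> d [] ->;
    [constructor 3|constructor 1|constructor 2].
  by split => //; [constructor 2|constructor 3].
- exists (Some 0), None; split; last by move=> d [] ->;
    [constructor 1|constructor 3|constructor 2].
  by split => //; [constructor 1|constructor 3].
- exists (Some 0), (Some 1); split; last by move=> d [] ->;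
    [constructor 1|constructor 2|constructor 3].
  by split => //; [constructor 1|constructor 2].
Qed.

End Circles.

(** * Parallel transport around the cusps *)

Section Monodromy.
Variables (R : realType) (n : nat) (V : local_system R n).
Local Notation C := (R[i]^o).
Local Notation F := (ls_etale V).
Implicit Types (s t : sec V) (z w : C) (a b c d : P1 R) (k : R).

Lemma parallel_flat_along a k (rho : R -> {z : C & V z}) : cusps a -> 1 < k ->
  parallel (circle a k) rho -> @flat_along R _ F (circle a k) rho 0 1.
Proof.
move=> ca k1 [tg par] u u01.
have [W [e [We Wu]]] := atlas_cover V (circle_Sline ca k1 u01).
pose x i := coord (e (tag (rho u))) i (tagged (rho u)).
exists (fun z => \sum_i x i *: tnth (e z) i).
  exact: frame_sec_flat_at We Wu.
have coords : \forall u' \near u, forall i, 0 <= u' <= 1 ->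
    coord (e (tag (rho u'))) i (tagged (rho u')) = x i.
  exact: (filter_forall _ (fun i => par W e i u We u01 Wu)).
have gW : \forall u' \near u, W (circle a k u').
  apply: (@continuous_circle R a k _ u); first by lra.
  exact: nbhs_atlas We Wu.
apply: filterS (filterI coords gW) => u' [co Wu'] u'01.
have total (p : {z : C & V z}) z' : tag p = z' -> W z' ->
    (forall i, coord (e (tag p)) i (tagged p) = x i) ->
    p = existT (fun z => V z) z' (\sum_i x i *: tnth (e z') i).
  case: p => z v /= <- Wz h; congr existT; apply: (atlas_coordP We Wz) => i.
  by rewrite (atlas_coord_sum _ _ We Wz) h.
by apply: total => [||i]; [exact: tg|exact: Wu'|exact: (co i u'01)].
Qed.

Lemma two_gt1 : (1 : R) < 2.
Proof. by rewrite ltrDl ltr01. Qed.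

(** Transport of a fixed vector closes up, so [circle_extension] applies to it. *)
Lemma monodromy_fixed a (T : 'End(V (loop a 0))) v : cusps a ->
  local_monodromy T -> T v = v ->
  exists2 s, @flat_off R F a s & s (loop a 0) = v.
Proof.
move=> ca /(_ v)[rho]; move=> + Tv; rewrite Tv; move: v {T Tv}.
rewrite loop_circle => v [par r0 r1].
have [|s sF sE] := circle_extension ca two_gt1 (parallel_flat_along ca two_gt1 par).
  by rewrite r0 r1.
by exists s => //; apply: (@total_inj _ _ F); rewrite -sE r0.
Qed.

Lemma monodromy_global a (T : 'End(V (loop a 0))) s : cusps a ->
  local_monodromy T -> (forall z, Sline z -> sec_flat_at s z) ->
  T (s (loop a 0)) = s (loop a 0).
Proof.
move=> ca /(_ (s (loop a 0)))[rho]; move: (T _) => v + sF; move: v.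
rewrite loop_circle => v [par r0 r1].
apply: (@total_inj _ _ F); rewrite -r1.
rewrite (@flat_along_unique _ _ F (circle a 2) rho s 0 1 _ _ _ 0 1) ?lexx ?ler01 //.
- by rewrite circle1 // two_gt1.
- by apply: continuous_circle; rewrite gt_eqF.
- exact: parallel_flat_along ca two_gt1 par.
- move=> u u01; have Su := circle_Sline ca two_gt1 u01.
  by split => //; apply: sF.
Qed.

Lemma global_zero s p : (forall z, Sline z -> sec_flat_at s z) -> Sline p ->
  s p = 0 -> forall z, Sline z -> s z = 0.
Proof.
move=> sF /Sline_slit[d _ dp] sp0.
have slit0 b q : slit_plane b q -> s q = 0 -> forall z, slit_plane b z -> s z = 0.
  move=> bq sq0; apply: (@slit_unique R F b s (fun=> 0) q) => //= z bz.
    by apply: sF; apply: slit_Sline bz.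
  exact: sec_flat_at0.
have i0 b : slit_plane b ('i%C : C) by left; rewrite /= oner_neq0.
have si0 : s 'i%C = 0 by apply: (slit0 _ _ dp sp0); apply: i0.
by move=> z /Sline_slit[b _]; apply: (slit0 _ _ (i0 b) si0).
Qed.

Lemma flat_off_zero a k s : cusps a -> 1 < k -> @flat_off R F a s ->
  s 'i%C = 0 -> s (circle a k 0) = 0.
Proof.
move=> ca k1 sF s0; have [b [cb ba bp]] := circle0_slit ca k1.
apply: (@slit_unique R F b s (fun=> 0) 'i%C) bp => //=.
- by apply: sF.
- by move=> z _; apply: sec_flat_at0.
- by left; rewrite /= oner_neq0.
Qed.

End Monodromy.

(** * Vanishing of the first cohomology *)

Section Vanishing.
Variables (R : realType) (V : local_system R 4).
Local Notation C := (R[i]^o).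
Local Notation F := (ls_etale V).
Implicit Types (s t : sec V) (z w : C) (a b c d : P1 R).

Lemma flat_off_lin a (x y : R[i]) s t : @flat_off R F a s -> @flat_off R F a t ->
  @flat_off R F a (fun z => x *: s z + y *: t z).
Proof.
move=> fs ft b cb ba z bz; apply: sec_flat_atD; apply: sec_flat_atZ.
  exact: (fs b cb ba z bz).
exact: (ft b cb ba z bz).
Qed.

(** The eigenvectors [b0] and [b2] of the two Jordan blocks are fixed and extend. A linear relation
    between the extensions at ['i] would propagate to the start of the loop, where they are
    independent. *)
Lemma type_II_sections a (T : 'End(V (loop a 0))) : cusps a ->
  local_monodromy T -> type_II T ->
  exists s t, [/\ @flat_off R F a s, @flat_off R F a t &
    forall x y : R[i], x *: s 'i%C + y *: t 'i%C = 0 -> x = 0 /\ y = 0].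
Proof.
move=> ca mT [b0 [b1 [b2 [b3 [/basis_free fb [T0 _ T2 _]]]]]].
have [s sF s0] := monodromy_fixed ca mT T0.
have [t tF t0] := monodromy_fixed ca mT T2.
exists s, t; split => // x y.
move=> /(flat_off_zero ca (@two_gt1 R) (flat_off_lin x y sF tF)).
rewrite -loop_circle s0 t0 => E.
pose k := [ffun i : 'I_4 => if i == 0 :> nat then x else if i == 2 :> nat then y else 0].
have : free [tuple b0; b1; b2; b3] := fb; move=> /freeP/(_ k).
rewrite !big_ord_recl big_ord0 !ffunE /= !scale0r !add0r !addr0 => /(_ E) H.
by have := H (inord 0); have := H (inord 2); rewrite !ffunE !inordK.
Qed.

Lemma atlas_dim z : Sline z -> \dim {: V z} = 4%N.
Proof.
move=> /(atlas_cover V)[W [e [We Wz]]].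
exact: size_basis (atlas_basis We Wz).
Qed.

Lemma eigen1_eq0 (E : vectType R[i]) (T : 'End(E)) v : eigen T 1 = 0%VS ->
  T v = v -> v = 0.
Proof.
move=> E0 Tv; apply/eqP; rewrite -memv0 -E0 memv_ker.
by rewrite add_lfunE opp_lfunE scale_lfunE id_lfunE Tv scale1r subrr.
Qed.

Lemma type_II_IV_h1 c : cusps c ->
  (exists T : 'End(V (loop c 0)), local_monodromy T /\ eigen T 1 = 0%VS) ->
  (forall a, cusps a -> a <> c ->
     exists T : 'End(V (loop a 0)), local_monodromy T /\ type_II T) ->
  forall cc : cochain1 V, cocycle cc -> coboundary cc.
Proof.
move=> Cc [T [mT T1]] II cc [U [Uc cF cD]].
have [a [b [[Ca Cb ab ac bc] abc]]] := other_cusps Cc.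
have [Ta [mTa IIa]] := II a Ca ac; have [Tb [mTb IIb]] := II b Cb bc.
have [s0 [s1 [fs0 fs1 sfree]]] := type_II_sections Ca mTa IIa.
have [t0 [t1 [ft0 ft1 tfree]]] := type_II_sections Cb mTb IIb.
have ip d : slit_plane d ('i%C : C) by left; rewrite /= oner_neq0.
(* The two planes of values at ['i] meet in 0: a common vector gives a global flat section, whose
   value on the loop around [c] is fixed by [T]. *)
have indep (x y x' y' : R[i]) :
    x *: s0 'i%C + y *: s1 'i%C = x' *: t0 'i%C + y' *: t1 'i%C ->
    [/\ x = 0, y = 0, x' = 0 & y' = 0].
  move=> E.
  have [r rF rst] := cusp_glue Ca Cb Cc ab ac bc abc
    (flat_off_lin x y fs0 fs1)
    (flat_off_lin x' y' ft0 ft1) (ip c) E.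
  have Sc : Sline (loop c 0).
    by rewrite loop_circle; apply: circle_Sline; rewrite ?two_gt1 ?lexx ?ler01.
  have r0 : r 'i%C = 0.
    apply: (global_zero rF Sc); last exact: slit_Sline (ip c).
    by apply: (eigen1_eq0 T1); apply: monodromy_global.
  have [rs rt] := rst _ (ip c).
  have [-> ->] := sfree x y (etrans (esym rs) r0).
  by have [-> ->] := tfree x' y' (etrans (esym rt) r0).
pose G := torsor_etale Uc cF cD.
(* On a small circle inside [U d], the zero section of the chart [d] is a closed flat path of the
   torsor. *)
have local_torsor d : cusps d -> exists s, @flat_off R G d s.
  move=> Cd; have [oU Ud] := Uc d.
  have [k k1 kU] := circle_near oU Ud.
  have chart th : 0 <= th <= 1 -> @flat_at R _ G (fun w => cc d (Some w) w) (circle d k th).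
    by move=> h; apply: torsor_chart_flat => //; apply: circle_Sline.
  have [|s sF _] := circle_extension Cd k1 (@flat_along_section R _ G (circle d k) _ 0 1 chart).
    by rewrite circle1.
  by exists s.
have [s sF] := local_torsor a Ca; have [t tF] := local_torsor b Cb.
pose X := [tuple s0 'i%C; s1 'i%C; t0 'i%C; t1 'i%C].
have bX : basis_of fullv X.
  rewrite basisEfree subvf (atlas_dim (slit_Sline (ip c))) size_tuple leqnn !andbT.
  apply/freeP => k; rewrite !big_ord_recl big_ord0 addr0 /= addrA => /eqP.
  rewrite addr_eq0 opprD -!scaleNr => /eqP/indep[k0 k1 /eqP k2 /eqP k3].
  move: k2 k3; rewrite !oppr_eq0 => /eqP k2 /eqP k3.
  move=> i; have : i \in enum 'I_4 by rewrite mem_enum.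
  by rewrite !enum_ordSl enum_ord0 /= !inE => /or4P[] /eqP ->.
have [x [y [x' [y' E]]]] : exists x y x' y' : R[i],
    t 'i%C - s 'i%C = x *: s0 'i%C + y *: s1 'i%C + (x' *: t0 'i%C + y' *: t1 'i%C).
  have := coord_basis bX (memvf (t 'i%C - s 'i%C)).
  by rewrite !big_ord_recl big_ord0 addr0 /= addrA => ->; do 4 eexists.
(* The difference of [t] and [s] at ['i] splits along the two planes; moving each part to its own
   section makes the two agree there. *)
have [|||r rF _] := @cusp_glue R G a b c (fun z => s z + (x *: s0 z + y *: s1 z))
   (fun z => t z + ((- x') *: t0 z + (- y') *: t1 z)) 'i%C Ca Cb Cc ab ac bc abc _ _ (ip c).
- move=> d Cd da z dz; apply: torsor_flat_atD; first exact: (sF d Cd da z dz).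
  exact: (@flat_off_lin a x y s0 s1 fs0 fs1 d Cd da z dz).
- move=> d Cd da z dz; apply: torsor_flat_atD; first exact: (tF d Cd da z dz).
  exact: (@flat_off_lin b (- x') (- y') t0 t1 ft0 ft1 d Cd da z dz).
- rewrite !scaleNr -opprD /=; move/eqP: E; rewrite subr_eq => /eqP ->.
  by rewrite addrAC addrK addrC.
exact: torsor_coboundary rF.
Qed.
End Vanishing.

(** * Harmonic representatives *)

Section Wirtinger.
Variable R : realType.
Local Notation C := (R[i]^o).
Implicit Types (z w : C) (f g : C -> C) (h : R * R -> R) (p v : R * R).

Lemma derivable_line h p v (t : R) : derivable h (p + t *: v) v ->
  is_derive t 1 (fun t : R => h (p + t *: v)) ('D_v h (p + t *: v)).
Proof.
have E : (fun r : R => r^-1 *: (h (p + (r *: 1 + t) *: v) - h (p + t *: v))) =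
    (fun r => r^-1 *: (h (r *: v + (p + t *: v)) - h (p + t *: v))).
  apply/funext => r; congr (_ *: (h _ - _)).
  by rewrite -[r *: 1]/(r * 1) mulr1 scalerDl addrCA.
by move=> hd; split; rewrite /derivable /derive ?E.
Qed.

Lemma derive_pair h p (a b : R) : differentiable h p ->
  'D_(a, b) h p = a * 'D_(1, 0) h p + b * 'D_(0, 1) h p.
Proof.
move=> hp; rewrite !deriveE //.
have -> : (a, b) = a *: (1, 0) + b *: (0, 1) :> R * R.
  by congr pair; rewrite /= /GRing.scale /= ?mulr1 ?mulr0 ?addr0 ?add0r.
by rewrite linearD !linearZ.
Qed.

Lemma ofC_seg z w (t : R) : toC (ofC z + t *: (ofC w - ofC z)) = seg z w t.
Proof. by apply: complex_eqP; rewrite ?Re_seg ?Im_seg. Qed.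

(** The mean value theorem for [h - h'] on the segment from [z] to [w], where its directional
    derivative vanishes. *)
Lemma same_partials_box h h' (O : set C) z (e : R) : box z e `<=` O -> 0 < e ->
  (forall w, O w -> [/\ differentiable h (ofC w), differentiable h' (ofC w),
     'D_(1, 0) h (ofC w) = 'D_(1, 0) h' (ofC w) &
     'D_(0, 1) h (ofC w) = 'D_(0, 1) h' (ofC w)]) ->
  forall w, box z e w -> h (ofC w) - h' (ofC w) = h (ofC z) - h' (ofC z).
Proof.
move=> zO e0 hh w zw; pose v := ofC w - ofC z.
pose k (t : R) := h (ofC z + t *: v) - h' (ofC z + t *: v).
have dk (t : R) : t \in `[0, 1] -> is_derive t 1 k 0.
  rewrite in_itv /= => t01.
  have := hh _ (zO _ (box_convex (box_center z e0) zw t01)).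
  have -> : ofC (seg z w t) = ofC z + t *: v.
    by rewrite -ofC_seg -/v; case: (ofC z + t *: v).
  move=> [d d' E E'].
  have -> : 0 = 'D_v h (ofC z + t *: v) - 'D_v h' (ofC z + t *: v).
    by rewrite (surjective_pairing v) (derive_pair _ _ d) (derive_pair _ _ d') E E' subrr.
  by apply: is_deriveB; apply: derivable_line; apply: diff_derivable.
have di (t : R) : t \in `]0, 1[ -> is_derive t 1 k 0.
  by rewrite in_itv /= => t01; apply: dk; rewrite in_itv /=; lra.
have kc : {within `[0, 1], continuous k}.
  by apply: derivable_within_continuous => t t01; have [] := dk t t01.
have [t _] := @MVT_segment R k (fun=> 0) 0 1 ler01 di kc.
rewrite mul0r => /eqP; rewrite subr_eq0 => /eqP.
by rewrite /k scale1r scale0r addr0 /v [ofC z + _]addrC subrK.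
Qed.

(** The sum of the two Wirtinger derivatives is the derivative in the real direction; the other one
    then follows on cancelling ['i]. *)
Lemma wirtinger_rderiv f g z : d_z f z = d_z g z -> d_zbar f z = d_zbar g z ->
  rderiv (1, 0) f z = rderiv (1, 0) g z /\ rderiv (0, 1) f z = rderiv (0, 1) g z.
Proof.
rewrite /d_z /d_zbar; set a := rderiv _ f z; set b := rderiv _ f z.
set a' := rderiv _ g z; set b' := rderiv _ g z => E1 E2.
have n2 : (2 : C) != 0 by rewrite pnatr_eq0.
have {}E1 := mulIf (invr_neq0 n2) E1; have {}E2 := mulIf (invr_neq0 n2) E2.
have Ea : a = a'.
  apply: (mulfI n2); have := congr2 +%R E1 E2.
  by rewrite addrACA addNr addr0 addrACA addNr addr0 -!mulr2n !mulr_natl.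
split=> //; move: E2; rewrite Ea => /addrI; apply: mulfI; exact: neq0Ci.
Qed.

Lemma wirtinger_loc_const (O : set C) f g z : Cinfty O f -> Cinfty O g ->
  (forall w, O w -> d_z f w = d_z g w) ->
  (forall w, O w -> d_zbar f w = d_zbar g w) ->
  nbhs z O -> \forall w \near z, f w - g w = f z - g z.
Proof.
move=> /(_ 1%N)[[fr _ _] [fi _ _]] /(_ 1%N)[[gr _ _] [gi _ _]] Ez Ezb.
move=> /nbhs_boxP[e e0 eO]; apply/nbhs_boxP; exists e => // w zw.
have toCK x : toC (ofC x) = x by case: x.
have part x : O x -> rderiv (1, 0) f x = rderiv (1, 0) g x /\
    rderiv (0, 1) f x = rderiv (0, 1) g x.
  by move=> Ox; apply: wirtinger_rderiv; [exact: Ez|exact: Ezb].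
have HR := @same_partials_box (rpart f) (rpart g) O z e eO e0.
have HI := @same_partials_box (ipart f) (ipart g) O z e eO e0.
apply: complex_eqP; rewrite !ReD !ReN || rewrite !ImD !ImN.
- have := HR _ w zw; rewrite /rpart !toCK; apply=> x Ox.
  have [[E _] [E' _]] := part x Ox.
  by split => //; [apply: fr|apply: gr]; rewrite /preimage /= toCK.
- have := HI _ w zw; rewrite /ipart !toCK; apply=> x Ox.
  have [[_ E] [_ E']] := part x Ox.
  by split => //; [apply: fi|apply: gi]; rewrite /preimage /= toCK.
Qed.

End Wirtinger.

(** * Zucker classes as cocycles *)

Section Zucker.
Variables (R : realType) (k n : nat) (V : real_vhs R k n) (Q : polarization V).

(** Additivity is that of differences. For flatness, [u x] and [u y] are primitives of the same form
    on the overlap, so their coordinates in a frame have equal Wirtinger derivatives and differ by a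
    locally constant function. *)
Lemma zucker_cocycle p q (cc : cochain1 V) : zucker_class Q p q cc -> cocycle cc.
Proof.
move=> [U [u [eta1 [eta2 [[Uc us u1 u2 uc] _]]]]].
exists U; split => //; last first.
  move=> x y w z [Sz [[xz yz] wz]].
  have -> : cc x w z = u w z - u x z by apply: uc.
  have -> : cc x y z = u y z - u x z by apply: uc.
  have -> : cc y w z = u w z - u y z by apply: uc.
  by rewrite [RHS]addrC addrA subrK.
move=> x y W e We i z [[Sz [xz yz]] Wz].
pose f x z := coord (e z) i (u x z).
pose O := trace (U x `&` U y) `&` W.
have zO : nbhs z O.
  apply: filterI (nbhs_atlas We Wz); apply: (nbhs_trace _ _ Sz); last by split.
  by have [oU _] := Uc x; have [oU' _] := Uc y; apply: openI.
have Oxy w : O w -> (trace (U x) `&` W) w /\ (trace (U y) `&` W) w.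
  by move=> [[Sw [xw yw]] Ww];
    exact: (conj (conj (conj Sw xw) Ww) (conj (conj Sw yw) Ww)).
have zbarE w : O w -> d_zbar (f y) w = d_zbar (f x) w.
  by move=> /Oxy[wx wy]; rewrite -(u2 x W e We i w wx) -(u2 y W e We i w wy).
have zE w : O w -> d_z (f y) w = d_z (f x) w.
  by move=> /Oxy[wx wy]; rewrite -(u1 x W e We i w wx) -(u1 y W e We i w wy).
have Ck_sub j (A B : set (R * R)) h : B `<=` A -> Ck j A h -> Ck j B h.
  move=> BA; elim: j h => [|j IH] h /= hA; first by move=> r /BA; apply: hA.
  by have [h1 h2 h3] := hA; split; [move=> r /BA; apply: h1|apply: IH|apply: IH].
have smoothO x' : U x' = U x \/ U x' = U y -> Cinfty O (f x').
  move=> Ux' j; have OU : @toC R @^-1` O `<=` @toC R @^-1` (trace (U x') `&` W).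
    by move=> r /Oxy[] ? ?; case: Ux' => ->.
  by have [h1 h2] := us x' W e We i j; split; apply: Ck_sub OU _.
have H := wirtinger_loc_const (smoothO y (or_intror erefl)) (smoothO x (or_introl erefl))
  zE zbarE zO.
apply: filterS (filterI zO H) => w [[[Sw [xw yw]] _] E].
have -> : cc x y w = u y w - u x w by apply: uc.
have -> : cc x y z = u y z - u x z by apply: uc.
by rewrite !linearB.
Qed.

Lemma coboundary_ext (c c' : cochain1 V) : (forall x y z, c x y z = c' x y z) ->
  coboundary c -> coboundary c'.
Proof.
by move=> E [U [b [Uc bF bE]]]; exists U, b; split => // x y z h; rewrite -E bE.
Qed.

(** Coefficients indexed by the empty type are unique; the empty sum changes a cochain only up to
    pointwise equality, whence the first hypothesis. *)
Lemma quot_dim0 (A B : cochain1 V -> Prop) :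
  (forall c c', (forall x y z, c x y z = c' x y z) -> B c -> B c') ->
  (forall c, A c -> B c) -> quot_dim A B 0.
Proof.
move=> Bext AB; exists (fun _ _ _ _ => 0); split=> [[]//|c Ac].
exists [ffun=> 0]; split=> [|a _]; last by apply/ffunP => -[].
by apply: Bext (AB c Ac) => x y z; rewrite big_ord0 subr0.
Qed.

End Zucker.

Theorem corollary5p5 (R : realType) (V : real_vhs R 3 4)
    (Q : polarization V) (hV : rohde_family V) :
  h1_jstar V 0 /\
  [/\ h1_hodge Q 4 0 0, h1_hodge Q 0 4 0, h1_hodge Q 3 1 0,
      h1_hodge Q 1 3 0 & h1_hodge Q 2 2 0].
Proof.
have [s4 [cs4 [[T [mT [_ T1]]] II]]] := monodromy hV.
have H1 : forall c : cochain1 V, cocycle c -> coboundary c.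
  by apply: (type_II_IV_h1 cs4) => //; exists T.
have ext := @coboundary_ext R 3 4 V.
(* Every Hodge piece consists of cocycles modulo coboundaries, so it vanishes with the whole
   group. *)
have hodge p q : h1_hodge Q p q 0.
  by apply: quot_dim0 => // c /zucker_cocycle; apply: H1.
by split; [exact: quot_dim0|split; exact: hodge].
Qed.
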